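(* Let $A$ be a separable $C^*$-algebra. Then every primitive ideal $I\in\operatorname{Prim}(A)$ has a countable base for its system of neighborhoods. Consequently, if $\mathcal F$ is a strictly norming set of representations of $A$, then $\mathcal F$ is exhausting.
   Context: A representation of $A$ is a $*$-morphism $\phi:A\to\mathcal L(\mathcal H_\phi)$ into the bounded operators on a Hilbert space. $\operatorname{Prim}(A)$ is the set of primitive ideals (kernels of irreducible representations) of $A$ with the Jacobson topology, whose open sets are the sets $\operatorname{Prim}(J)=\{I\in\operatorname{Prim}(A): J\not\subset I\}$ for closed two-sided ideals $J\subset A$. $A$ is not assumed unital. If $A$ has no unit, $A^+:=A\oplus\mathbb C$ is the algebra with adjoined unit, with its unique $C^*$-norm. A set $\mathcal F$ of representations of $A$ is strictly norming if: (for $A$ unital) for every $a\in A$ there is $\phi\in\mathcal F$ with $\|a\|=\|\phi(a)\|$; (for $A$ non-unital) for every $a\in A$ and $\lambda\in\mathbb C$, either there is $\phi\in\mathcal F$ with $\|\lambda+a\|=\|\lambda+\phi(a)\|$, or $\|\lambda+a\|=|\lambda|$ (norm of $\lambda+a$ in $A^+$). $\mathcal F$ is exhausting if for every irreducible representation $\pi$ of $A$ there is $\phi\in\mathcal F$ with $\ker(\phi)\subset\ker(\pi)$. *)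

(* Defs.v *)
From HB Require Import structures.
From mathcomp Require Import all_boot all_order all_algebra.
From mathcomp Require Import ring.
From mathcomp Require Import sesquilinear complex.
From mathcomp Require Import boolp classical_sets functions cardinality reals.
From mathcomp Require Import interval_inference topology normedtype sequences.

Set Implicit Arguments.
Unset Strict Implicit.
Unset Printing Implicit Defensive.

Import Order.TTheory GRing.Theory Num.Theory.
Import numFieldNormedType.Exports.

Local Open Scope classical_set_scope.
Local Open Scope ring_scope.
Local Open Scope complex_scope.

(* The library has no non-unital algebras, so the product of a C^*-algebra is
   given here with its axioms; no unit is assumed. The norm of a normed module
   over R[i] takes its values in R[i] (on the nonnegative real half-line). *)
HB.mixin Record CompleteNormedModule_isCStarAlgebra (R : realType) A
    & CompleteNormedModule R[i] A := {
  cmul : A -> A -> A ;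
  cstar : A -> A ;
  cmulA : associative cmul ;
  cmulDl : left_distributive cmul +%R ;
  cmulDr : right_distributive cmul +%R ;
  cmulZl : forall (k : R[i]) (a b : A), cmul (k *: a) b = k *: cmul a b ;
  cmulZr : forall (k : R[i]) (a b : A), cmul a (k *: b) = k *: cmul a b ;
  cstarK : involutive cstar ;
  cstarD : {morph cstar : a b / a + b} ;
  cstarZ : forall (k : R[i]) (a : A), cstar (k *: a) = Num.conj k *: cstar a ;
  cstarM : forall a b : A, cstar (cmul a b) = cmul (cstar b) (cstar a) ;
  cnormM : forall a b : A, `|cmul a b| <= `|a| * `|b| ;
  cnorm_star : forall a : A, `|cmul (cstar a) a| = `|a| ^+ 2
}.

#[short(type="cstarAlgType")]
HB.structure Definition CStarAlgebra (R : realType) :=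
  {A of CompleteNormedModule R[i] A & CompleteNormedModule_isCStarAlgebra R A}.

(* hdot is linear in its first argument and conjugate-linear in the second. *)
HB.mixin Record CompleteNormedModule_isHilbert (R : realType) H
    & CompleteNormedModule R[i] H := {
  hdot : {dot H for (@Num.conj R[i])} ;
  hnormE : forall x : H, `|x| ^+ 2 = hdot x x
}.

#[short(type="hilbertType")]
HB.structure Definition Hilbert (R : realType) :=
  {H of CompleteNormedModule R[i] H & CompleteNormedModule_isHilbert R H}.

(* The supremum of |f x| over the unit ball, as an element of R[i]; it is the
   operator norm when f is linear and bounded. *)
Definition opnorm (R : realType) (V W : normedModType R[i]) (f : V -> W) : R[i] :=
  (sup [set complex.Re `|f x| | x in [set x : V | `|x| <= 1]])%:C.

Definition unital (R : realType) (A : cstarAlgType R) : Prop :=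
  exists e : A, forall a : A, cmul e a = a /\ cmul a e = a.

(* A^+ : the pair (a, k) stands for k + a. The norm below is definite only when
   A has no unit, hence the proof argument. *)
Definition unitization (R : realType) (A : cstarAlgType R) (nuA : ~ unital A)
  : Type := (A * R[i])%type.

HB.instance Definition _ (R : realType) (A : cstarAlgType R) (nuA : ~ unital A) :=
  GRing.Lmodule.copy (unitization nuA) (A * R[i]^o)%type.

Section opnorm_theory.
Variables (R : realType) (V W : normedModType R[i]).
Implicit Types (f : V -> W) (M : R[i]).

Lemma ge0_complexRe (c : R[i]) : 0 <= c -> c = (complex.Re c)%:C.
Proof. by case: c => a b; rewrite lecE /= => /andP[/eqP -> _]. Qed.

Lemma le_complexRe (c d : R[i]) : c <= d -> complex.Re c <= complex.Re d.
Proof. by rewrite lecE => /andP[]. Qed.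

Lemma opnorm_le f M : (forall x, `|x| <= 1 -> `|f x| <= M) -> opnorm f <= M.
Proof.
move=> fM; have M0 : 0 <= M by apply: le_trans (fM 0 _) => //; rewrite normr0.
rewrite (ge0_complexRe M0) lecR; apply: ge_sup.
  by exists (complex.Re `|f 0|), 0 => //=; rewrite normr0.
by move=> _ [x /= x1 <-]; apply: le_complexRe; exact: fM.
Qed.

Lemma opnorm_ub f M x : (forall k y, f (k *: y) = k *: f y) ->
  (forall y, `|f y| <= M * `|y|) -> `|f x| <= opnorm f * `|x|.
Proof.
move=> fZ fM; have [->|x0] := eqVneq x 0.
  by rewrite -(scale0r 0) fZ !scale0r !normr0 mulr0.
have nx : 0 < `|x| by rewrite normr_gt0.
rewrite -ler_pdivrMr//.
have -> : `|f x| / `|x| = `|f (`|x|^-1 *: x)|.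
  by rewrite fZ normrZ ger0_norm ?invr_ge0// mulrC.
rewrite (ge0_complexRe (normr_ge0 (f _))) lecR; apply: ub_le_sup.
  exists (complex.Re `|M|) => _ [y y1 <-]; apply: le_complexRe.
  have M0 : 0 <= M by rewrite -(pmulr_lge0 _ nx) (le_trans _ (fM x)).
  by rewrite ger0_norm// (le_trans (fM y))// ler_piMr.
exists (`|x|^-1 *: x) => //=.
by rewrite normrZ ger0_norm ?invr_ge0// mulVf// gt_eqF.
Qed.

Lemma opnorm_ge0 f : 0 <= opnorm f.
Proof.
rewrite ler0c.
have [hs|/sup_out -> //] := pselect (has_sup [set complex.Re `|f x| | x in [set x : V | `|x| <= 1]]).
apply: (@le_trans _ _ (complex.Re `|f 0|)); first by rewrite -ler0c -ge0_complexRe.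
by apply: ub_le_sup; [case: hs|exists 0 => //=; rewrite normr0].
Qed.

End opnorm_theory.

Lemma complex_complete (R : realType) (F : set_system R[i]^o) :
  ProperFilter F -> cauchy F -> cvg F.
Proof.
move=> FF /cauchy_ballP Fc.
have reC (p : R[i] -> R) : (forall x y, `|p x - p y|%:C <= `|x - y|) ->
    cvg (p @ F).
  move=> pl; apply: (@cauchy_cvg R) => //; apply/cauchy_ballP => e e0.
  have e0' : 0 < e%:C by rewrite ltcR.
  have := Fc _ e0'; rewrite !near2E /=.
  case=> -[P Q] /= [FP FQ] PQ; exists (p @` P, p @` Q) => /=.
    by split; [apply: filterS FP|apply: filterS FQ] => x Px /=; exists x.
  move=> [_ _] /= [[x Px <-] [y Qy <-]].
  have /= := PQ (x, y) (conj Px Qy); rewrite -!ball_normE /= -ltcR.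
  by apply: le_lt_trans; exact: pl.
have /cvg_ex[/= a Fa] : cvg (@complex.Re R @ F).
  by apply: reC => -[a b] [c d] /=; exact: (normc_ge_Re ((a - c) +i* (b - d))).
have /cvg_ex[/= b Fb] : cvg (@complex.Im R @ F).
  apply: reC => -[a' b] [c d] /=.
  have := normc_ge_Re (((a' - c) +i* (b - d)) * 'i%C).
  rewrite normrM (_ : `|'i%C| = 1); last by rewrite normc_def /= expr0n add0r expr1n sqrtr1.
  by rewrite mulr1 ReiNIm normrN.
apply/cvg_ex; exists (a +i* b) => /=.
apply/cvgrPdist_lt => e e0.
have eE : e = (complex.Re e)%:C by apply: ge0_complexRe; exact: ltW.
have re0 : 0 < complex.Re e by rewrite -ltcR -eE.
move/cvgrPdist_lt : Fa => /(_ (complex.Re e / 2)); rewrite divr_gt0// => /(_ isT) Fa.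
move/cvgrPdist_lt : Fb => /(_ (complex.Re e / 2)); rewrite divr_gt0// => /(_ isT) Fb.
near=> z.
have -> : a +i* b - z = (a - complex.Re z)%:C + (b - complex.Im z)%:C * 'i%C.
  by case: (z) => u v; apply/eqP; rewrite eq_complex /=; simpc.
rewrite (le_lt_trans (ler_normD _ _))// normrM.
rewrite (_ : `|'i%C| = 1); last by rewrite normc_def /= expr0n add0r expr1n sqrtr1.
rewrite mulr1 !normc_def /= !expr0n !addr0 !sqrtr_sqr -rmorphD eE ltcR (splitr (complex.Re e)).
by rewrite ltrD//; near: z.
Unshelve. all: by end_near. Qed.

Section CStarAlgebra_theory.
Variables (R : realType) (A : cstarAlgType R).
Implicit Types (a b : A).

Lemma cmul0l a : cmul 0 a = 0.
Proof. by rewrite -(scale0r 0) cmulZl !scale0r. Qed.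

Lemma cmul0r a : cmul a 0 = 0.
Proof. by rewrite -(scale0r 0) cmulZr !scale0r. Qed.

Lemma cstar0 : cstar 0 = 0 :> A.
Proof. by rewrite -(scale0r 0) cstarZ conjC0 !scale0r. Qed.

Lemma cmulNl a b : cmul (- a) b = - cmul a b.
Proof. by rewrite -scaleN1r cmulZl scaleN1r. Qed.

Lemma cmulNr a b : cmul a (- b) = - cmul a b.
Proof. by rewrite -scaleN1r cmulZr scaleN1r. Qed.

Lemma cstarN a : cstar (- a) = - cstar a.
Proof. by rewrite -scaleN1r cstarZ rmorphN1 scaleN1r. Qed.

Lemma cnorm_starE a : `|cstar a| = `|a|.
Proof.
suff le_star b : `|b| <= `|cstar b|.
  by apply/le_anti; rewrite le_star -{2}(cstarK a) le_star.
have [->|b0] := eqVneq b 0; first by rewrite normr0.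
have nb : 0 < `|b| by rewrite normr_gt0.
by rewrite -(ler_pM2r nb) -expr2 -cnorm_star cnormM.
Qed.

Lemma cstarmul_eq0 a : cmul (cstar a) a = 0 -> a = 0.
Proof.
by move=> a0; apply/eqP; rewrite -normr_eq0 -sqrf_eq0 -cnorm_star a0 normr0.
Qed.

End CStarAlgebra_theory.

Section unitization.
Variables (R : realType) (A : cstarAlgType R) (nuA : ~ unital A).
Local Notation Ap := (unitization nuA).
Implicit Types (x y : Ap) (k : R[i]) (a b : A).

(* left multiplication by x on A, seen as an ideal of A^+ *)
Definition unitization_lmul x : A -> A := fun b => cmul x.1 b + x.2 *: b.
Local Notation L := unitization_lmul.

Definition unitization_mul x y : Ap :=
  (cmul x.1 y.1 + x.2 *: y.1 + y.2 *: x.1, x.2 * y.2).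

Definition unitization_star x : Ap := (cstar x.1, Num.conj x.2).

(* The norm of left multiplication by x on A; the instance at the end of this
   section shows that it makes A^+ a C^*-algebra. *)
Definition unitization_norm x : R[i] := opnorm (L x).
Local Notation N := unitization_norm.

Let LZ x k b : L x (k *: b) = k *: L x b.
Proof. by rewrite /L cmulZr scalerDr !scalerA mulrC. Qed.

Let L_bound x b : `|L x b| <= (`|x.1| + `|x.2|) * `|b|.
Proof. by rewrite mulrDl (le_trans (ler_normD _ _))// lerD ?cnormM// normrZ. Qed.

Let NP x b : `|L x b| <= N x * `|b|.
Proof. by apply: opnorm_ub => [k y|y]; [exact: LZ|exact: L_bound]. Qed.

Let N_ge0 x : 0 <= N x. Proof. exact: opnorm_ge0. Qed.

Let N_le x M : 0 <= M -> (forall b, `|L x b| <= M * `|b|) -> N x <= M.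
Proof.
move=> M0 xM; apply: opnorm_le => b b1.
by rewrite (le_trans (xM b))// ler_piMr.
Qed.

Let N_normD x y : N (x + y) <= N x + N y.
Proof.
apply: N_le => [|b]; first by rewrite addr_ge0.
rewrite (_ : L (x + y) b = L x b + L y b).
  by rewrite (le_trans (ler_normD _ _))// mulrDl lerD.
by rewrite /L /= cmulDl scalerDl addrACA.
Qed.

Let N_Z_le k x : N (k *: x) <= `|k| * N x.
Proof.
apply: N_le => [|b]; first by rewrite mulr_ge0.
rewrite (_ : L (k *: x) b = k *: L x b).
  by rewrite normrZ -mulrA ler_wpM2l.
by rewrite /L /= cmulZl -scalerA scalerDr.
Qed.

Let N_Z k x : N (k *: x) = `|k| * N x.
Proof.
apply/le_anti; rewrite N_Z_le /=.
have [->|k0] := eqVneq k 0; first by rewrite normr0 mul0r.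
have nk : 0 < `|k| by rewrite normr_gt0.
rewrite -ler_pdivlMl// -normfV.
by have := N_Z_le k^-1 (k *: x); rewrite scalerA mulVf// scale1r.
Qed.

Let L_eq0 x : (forall b, L x b = 0) -> x = 0.
Proof.
case: x => a k; rewrite /L /= => ak0.
have [k0|k0] := eqVneq k 0.
  rewrite k0 in ak0 *; rewrite (_ : a = 0)//.
  rewrite -[a]cstarK (_ : cstar a = 0) ?cstar0//; apply: cstarmul_eq0.
  by rewrite cstarK; have := ak0 (cstar a); rewrite scale0r addr0.
exfalso; apply: nuA; pose e := - (k^-1 *: a).
have el b : cmul e b = b.
  apply/eqP; rewrite cmulNl cmulZl eq_sym -addr_eq0.
  have /(congr1 (fun c => k^-1 *: c)) := ak0 b.
  by rewrite scaler0 scalerDr scalerA mulVf// scale1r addrC => ->.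
have er b : cmul b (cstar e) = b.
  by rewrite -{1}[b]cstarK -cstarM el cstarK.
have ee : cstar e = e by rewrite -[LHS]el er.
by exists e => b; split; [exact: el|rewrite -{1}ee er].
Qed.

Let N_eq0 x : N x = 0 -> x = 0.
Proof.
move=> x0; apply: L_eq0 => b; apply/eqP.
by rewrite -normr_le0 (le_trans (NP x b))// x0 mul0r.
Qed.

HB.instance Definition _ := Lmodule_isNormed.Build R[i] Ap N_normD N_Z N_eq0.

Lemma unitization_normE x : `|x| = opnorm (fun b => cmul x.1 b + x.2 *: b).
Proof. by []. Qed.

Definition inU a : Ap := (a, 0).
Definition unitU : Ap := (0, 1).

Lemma normr_inU a : `|inU a| = `|a|.
Proof.
apply/le_anti/andP; split.
  apply: N_le => // b.
  by rewrite /L /= scale0r addr0 cnormM.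
have [->|a0] := eqVneq a 0; first by rewrite normr0.
have na : 0 < `|a| by rewrite normr_gt0.
rewrite -(ler_pM2r na) -[X in _ <= _ * X]cnorm_starE.
rewrite (le_trans _ (NP _ _))// /L /= scale0r addr0.
rewrite (_ : cmul a _ = cmul (cstar (cstar a)) (cstar a)); last by rewrite cstarK.
by rewrite cnorm_star cnorm_starE expr2.
Qed.

Lemma unitizationE x : x = inU x.1 + x.2 *: unitU.
Proof.
case: x => a k; rewrite /inU /unitU; congr pair => /=.
  by rewrite scaler0 addr0.
by rewrite add0r /GRing.scale /= mulr1.
Qed.

Let snd_bound : exists2 d : R[i], 0 < d & forall x, d * `|x.2| <= `|x|.
Proof.
have [[d d0 dP]|nd] := pselect (exists2 d : R[i], 0 < d & forall a, d <= `|inU a + unitU|).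
  exists d => // x; have [x20|x20] := eqVneq x.2 0.
    by rewrite x20 normr0 mulr0.
  have nx : 0 < `|x.2| by rewrite normr_gt0.
  rewrite -ler_pdivlMr// mulrC -normfV -normrZ.
  suff -> : x.2^-1 *: x = inU (x.2^-1 *: x.1) + unitU by [].
  rewrite {2}[x]unitizationE scalerDr scalerA mulVf// scale1r; congr (_ + _).
  by rewrite /inU; congr pair; rewrite /= scaler0.
exfalso.
have sq n : exists a, `|inU a + unitU| < n.+1%:R^-1.
  apply: contrapT => /forallNP nn; apply: nd; exists n.+1%:R^-1; [by rewrite invr_gt0 ltr0n|move=> a].
  rewrite real_leNgt ?ger0_real ?invr_ge0//; apply/negP; exact: nn.
have /choice[u uP] := sq.
have near_small e : 0 < e -> \forall n \near \oo, n.+1%:R^-1 < e :> R[i].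
  move=> e0; have eE : e = (complex.Re e)%:C by apply: ge0_complexRe; exact: ltW.
  have re0 : 0 < complex.Re e by rewrite -ltcR -eE.
  move: re0 eE; move: (complex.Re e) => _/posnumP[r] eE.
  near=> n; rewrite eE (_ : n.+1%:R^-1 = (n.+1%:R^-1)%:C).
    by rewrite ltcR; near: n; exact: near_infty_natSinv_lt.
  by rewrite fmorphV rmorph_nat.
have inUB a b : inU a + unitU - (inU b + unitU) = inU (a - b).
  rewrite opprD addrACA subrr addr0; congr pair => /=; exact: subr0.
have /cvg_ex[/= l ul] : cvg (u n @[n --> \oo]).
  apply: cauchy_cvg; apply: cauchy_exP => e e0.
  have e20 : 0 < e / 2 by rewrite divr_gt0.
  have /near_small[n _ nP] := e20.
  exists (u n); exists n => // m /= nm.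
  rewrite -ball_normE /= -normr_inU -inUB (le_lt_trans (ler_normB _ _))//.
  rewrite (splitr e) ltrD//.
    by rewrite (lt_trans (uP n))// nP//=.
  by rewrite (lt_trans (uP m))// nP//=.
have : inU l + unitU = 0.
  apply: contrapT => /eqP; rewrite -normr_gt0 => e0.
  have e20 : 0 < `|inU l + unitU| / 2 by rewrite divr_gt0.
  move/cvgrPdist_lt : ul => /(_ _ e20) ul.
  near \oo => n.
  suff : `|inU l + unitU| < `|inU l + unitU| by rewrite ltxx.
  rewrite -{1}(subrK (inU (u n) + unitU) (inU l + unitU)) inUB.
  rewrite (le_lt_trans (ler_normD _ _))// [ltRHS]splitr ltrD//.
    by rewrite normr_inU; near: n.
  by rewrite (lt_trans (uP n))//; near: n; exact: near_small.
move=> /(congr1 snd)/= /eqP.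
by rewrite add0r oner_eq0.
Unshelve. all: by end_near. Qed.

Let norm_unitU : `|unitU| <= 1.
Proof. by apply: N_le => // b; rewrite /L /= cmul0l add0r scale1r mul1r. Qed.

Let cauchy_lipschitz (V : normedModType R[i]) (p : Ap -> V) K (F : set_system Ap) :
  Filter F -> 0 < K -> (forall x y, `|p x - p y| <= K * `|x - y|) ->
  cauchy F -> cauchy (p @ F).
Proof.
move=> FF K0 pK /cauchy_ballP Fc; apply/cauchy_ballP => e e0.
have eK : 0 < K^-1 * e by rewrite mulr_gt0// invr_gt0.
have := Fc _ eK; rewrite !near2E /= => -[[P Q] /= [FP FQ] PQ].
exists (p @` P, p @` Q) => /=.
  by split; [apply: filterS FP|apply: filterS FQ] => x Px /=; exists x.
move=> [_ _] /= [[x Px <-] [y Qy <-]].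
have := PQ (x, y) (conj Px Qy); rewrite -!ball_normE /= ltr_pdivlMl//.
by apply: le_lt_trans; exact: pK.
Qed.

Let unitization_complete (F : set_system Ap) : ProperFilter F -> cauchy F -> cvg F.
Proof.
move=> FF Fc; have [d d0 dP] := snd_bound.
have sP x : `|x.2| <= d^-1 * `|x| by rewrite ler_pdivlMl.
have fP x : `|x.1| <= (1 + d^-1) * `|x|.
  rewrite -normr_inU (_ : inU x.1 = x - x.2 *: unitU); last first.
    by rewrite {2}[x]unitizationE addrK.
  rewrite (le_trans (ler_normB _ _))// mulrDl mul1r lerD2l normrZ.
  by rewrite (le_trans _ (sP x))// ler_piMr.
have d10 : 0 < d^-1 by rewrite invr_gt0.
have /cvg_ex[/= k Fk] : cvg ((fun x => x.2 : R[i]^o) @ F).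
  apply: complex_complete; apply: (@cauchy_lipschitz R[i]^o (fun x => x.2) _ F FF d10) => // x y.
  exact: (sP (x - y)).
have /cvg_ex[/= a Fa] : cvg ((fun x => x.1) @ F).
  apply: cauchy_cvg; apply: (@cauchy_lipschitz _ _ (1 + d^-1)) => //.
    by rewrite addr_gt0.
  move=> x y; exact: (fP (x - y)).
apply/cvg_ex; exists ((a, k) : Ap); apply/cvgrPdist_lt => e e0.
have e20 : 0 < e / 2 by rewrite divr_gt0.
move/cvgrPdist_lt : Fa => /(_ _ e20) Fa.
move/cvgrPdist_lt : Fk => /(_ _ e20) Fk.
near=> x; rewrite [_ - x]unitizationE (le_lt_trans (ler_normD _ _))//.
rewrite [e]splitr normr_inU ltr_leD//; first by near: x.
rewrite normrZ (@le_trans _ _ `|k - x.2|)//; first by rewrite ler_piMr.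
by apply: ltW; near: x; exact: Fk.
Unshelve. all: by end_near. Qed.

HB.instance Definition _ := Uniform_isComplete.Build Ap unitization_complete.

Let unitization_mulA : associative unitization_mul.
Proof.
move=> [a k] [b l] [c m]; congr pair => /=; last by rewrite mulrA.
rewrite !(cmulDl, cmulDr, scalerDr, cmulZl, cmulZr, scalerA) cmulA !addrA.
by rewrite [LHS](ACl (1*4*2*5*3*6*7)) [m * k]mulrC [m * l]mulrC.
Qed.

Let unitization_mulDl : left_distributive unitization_mul +%R.
Proof.
move=> [a k] [b l] [c m]; congr pair => /=; last by rewrite mulrDl.
rewrite !(cmulDl, cmulDr, scalerDr, scalerDl, cmulZl, cmulZr, scalerA) !addrA.
by rewrite [LHS](ACl (1*3*5*2*4*6)).
Qed.

Let unitization_mulDr : right_distributive unitization_mul +%R.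
Proof.
move=> [a k] [b l] [c m]; congr pair => /=; last by rewrite mulrDr.
rewrite !(cmulDl, cmulDr, scalerDr, scalerDl, cmulZl, cmulZr, scalerA) !addrA.
by rewrite [LHS](ACl (1*3*5*2*4*6)).
Qed.

Let unitization_mulZl k x y :
  unitization_mul (k *: x) y = k *: unitization_mul x y.
Proof.
congr pair => /=; last by rewrite /GRing.scale /= mulrA.
by rewrite cmulZl !scalerDr !scalerA [_ * y.2]mulrC.
Qed.

Let unitization_mulZr k x y :
  unitization_mul x (k *: y) = k *: unitization_mul x y.
Proof.
congr pair => /=; last by rewrite /GRing.scale /= mulrCA.
by rewrite cmulZr !scalerDr !scalerA [_ * k]mulrC.
Qed.

Let unitization_starK : involutive unitization_star.
Proof. by move=> [a k]; congr pair => /=; [exact: cstarK|exact: conjCK]. Qed.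

Let unitization_starD : {morph unitization_star : x y / x + y}.
Proof. by move=> x y; congr pair => /=; [exact: cstarD|exact: rmorphD]. Qed.

Let unitization_starZ k x :
  unitization_star (k *: x) = Num.conj k *: unitization_star x.
Proof. by congr pair => /=; [exact: cstarZ|exact: rmorphM]. Qed.

Let unitization_starM x y : unitization_star (unitization_mul x y) =
  unitization_mul (unitization_star y) (unitization_star x).
Proof.
congr pair => /=; last by rewrite rmorphM mulrC.
by rewrite !cstarD cstarM !cstarZ -!addrA; congr (_ + _); rewrite addrC.
Qed.

Let LM x y b : L (unitization_mul x y) b = L x (L y b).
Proof.
rewrite /L /= !(cmulDl, cmulDr, scalerDr, cmulZl, cmulZr, scalerA) cmulA.
by rewrite -!addrA; congr (_ + _); rewrite addrCA.
Qed.

Let unitization_normM x y : `|unitization_mul x y| <= `|x| * `|y|.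
Proof.
apply: N_le => [|b]; first by rewrite mulr_ge0.
by rewrite LM (le_trans (NP _ _))// -mulrA ler_wpM2l.
Qed.

Let norm_le_star x : `|x| ^+ 2 <= `|unitization_mul (unitization_star x) x|.
Proof.
set P := `|unitization_mul _ x|.
have P0 : 0 <= P by exact: normr_ge0.
have Lstar b c : cmul (cstar (L x b)) c = cmul (cstar b) (L (unitization_star x) c).
  by rewrite /L /= cstarD cstarZ cstarM cmulDl cmulDr cmulZl cmulZr cmulA.
have : `|x| <= sqrtC P.
  apply: N_le => [|b]; first by rewrite sqrtC_ge0.
  rewrite -(@ler_pXn2r _ 2) ?nnegrE ?mulr_ge0 ?sqrtC_ge0//.
  rewrite exprMn sqrtCK -cnorm_star Lstar -LM (le_trans (cnormM _ _))//.
  by rewrite cnorm_starE mulrC expr2 mulrA ler_wpM2r// NP.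
by rewrite -(@ler_pXn2r _ 2) ?nnegrE ?sqrtC_ge0// sqrtCK.
Qed.

Let unitization_norm_star x :
  `|unitization_mul (unitization_star x) x| = `|x| ^+ 2.
Proof.
apply/le_anti; rewrite norm_le_star andbT (le_trans (unitization_normM _ _))//.
rewrite expr2 ler_wpM2r//.
suff le_star y : `|y| <= `|unitization_star y|.
  by rewrite -{2}(unitization_starK x) le_star.
have [->|y0] := eqVneq y 0; first by rewrite normr0.
have ny : 0 < `|y| by rewrite normr_gt0.
by rewrite -(ler_pM2r ny) -expr2 (le_trans (norm_le_star y)).
Qed.

HB.instance Definition _ := CompleteNormedModule_isCStarAlgebra.Build R Ap
  unitization_mulA unitization_mulDl unitization_mulDr unitization_mulZl
  unitization_mulZr unitization_starK unitization_starD unitization_starZ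
  unitization_starM unitization_normM unitization_norm_star.

End unitization.

Record bounded_op (R : realType) (H : hilbertType R) := BoundedOp {
  bop :> {linear H -> H} ;
  bop_continuous : continuous bop
}.

Record representation (R : realType) (A : cstarAlgType R) := Representation {
  rep_space : hilbertType R ;
  rep_op :> A -> bounded_op rep_space ;
  rep_linear : forall (k : R[i]) (a b : A) (x : rep_space),
    rep_op (k *: a + b) x = k *: rep_op a x + rep_op b x ;
  repM : forall (a b : A) (x : rep_space),
    rep_op (cmul a b) x = rep_op a (rep_op b x) ;
  (* rep_op (cstar a) is the adjoint of rep_op a *)
  rep_star : forall (a : A) (x y : rep_space),
    hdot (rep_op a x) y = hdot x (rep_op (cstar a) y)
}.

Definition rep_ker (R : realType) (A : cstarAlgType R) (phi : representation A)
  : set A := [set a | forall x, phi a x = 0].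

Definition closed_subspace (R : realType) (V : normedModType R[i]) (K : set V)
  : Prop :=
  [/\ K 0, forall (k : R[i]) x y, K x -> K y -> K (k *: x + y) & closed K].

(* The second conjunct excludes the zero representation on a line, so that
   primitive ideals are proper. *)
Definition irreducible (R : realType) (A : cstarAlgType R)
    (pi : representation A) : Prop :=
  (exists a x, pi a x != 0) /\
  forall K : set (rep_space pi), closed_subspace K ->
    (forall a x, K x -> K (pi a x)) -> K = [set 0] \/ K = setT.

Definition closed_ideal (R : realType) (A : cstarAlgType R) (J : set A) : Prop :=
  closed_subspace J /\
  forall a b : A, J b -> J (cmul a b) /\ J (cmul b a).

Definition primitive (R : realType) (A : cstarAlgType R) (I : set A) : Prop :=
  exists2 pi : representation A, irreducible pi & I = rep_ker pi.

Definition Prim (R : realType) (A : cstarAlgType R) : Type :=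
  {I : set A | primitive I}.

Definition prim_open (R : realType) (A : cstarAlgType R) (J : set A)
  : set (Prim A) := [set I | ~ (J `<=` sval I)].

Section rep_theory.
Variables (R : realType) (A : cstarAlgType R).

Lemma eq0_small (V : normedModType R[i]) (z : V) (K : R[i]) : 0 < K ->
  (forall e : R[i], 0 < e -> exists2 w, w < e & `|z| <= K * w) -> z = 0.
Proof.
move=> K0 zK; apply: contrapT => /eqP; rewrite -normr_gt0 => z0.
have /zK[w] : 0 < K^-1 * `|z| by rewrite mulr_gt0// invr_gt0.
by rewrite ltr_pdivlMl// => /lt_le_trans/[apply]; rewrite ltxx.
Qed.

Lemma near_expr_small (r e : R[i]) : 0 <= r -> r < 1 -> 0 < e ->
  \forall n \near \oo, r ^+ n < e.
Proof.
move=> r0 r1 e0.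
have eE : e = (complex.Re e)%:C by apply: ge0_complexRe; exact: ltW.
have rE := ge0_complexRe r0; move: r0 r1 e0; rewrite rE eE.
move: (complex.Re r) (complex.Re e) => {eE rE}r {}e.
rewrite ler0c -(rmorph1 (real_complex R)) !ltcR => r0 r1 e0.
have rn : `|r| < 1 by rewrite ger0_norm.
have := cvg_expr rn; move/cvgrPdist_lt => /(_ _ e0); apply: filterS => n.
by rewrite sub0r normrN ger0_norm ?exprn_ge0// -rmorphXn ltcR.
Qed.

(* 1 - d has a self-adjoint square root 1 - c with c in A *)
Lemma cstar_sqrt (d : A) : cstar d = d -> `|d| < 1 ->
  exists2 c : A, cstar c = c & d = c *+ 2 - cmul c c.
Proof.
move=> ds d1; set r := `|d| in d1.
have r0 : 0 <= r by exact: normr_ge0.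
pose h : R[i] := 2^-1; pose T c := h *: (d + cmul c c).
have h0 : 0 < h by rewrite invr_gt0.
have h0' : 0 <= h by exact: ltW.
have hr : h + h = 1 by rewrite [RHS]splitr mul1r.
have TB c c' : `|T c - T c'| <= h * (`|c| + `|c'|) * `|c - c'|.
  rewrite -scalerBr opprD addrACA subrr add0r normrZ gtr0_norm// -mulrA ler_wpM2l//.
  have -> : cmul c c - cmul c' c' = cmul c (c - c') + cmul (c - c') c'.
    by rewrite cmulDr cmulDl cmulNr cmulNl addrA subrK.
  rewrite (le_trans (ler_normD _ _))// mulrDl lerD ?cnormM// mulrC.
  by rewrite mulrC (le_trans (cnormM _ _))// mulrC.
pose u n := iter n T 0.
have ur n : `|u n| <= r.
  elim: n => [|n ih]; first by rewrite normr0.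
  rewrite /u iterS -/(u n) /T normrZ gtr0_norm//.
  rewrite -[leRHS]mul1r -hr mulrDl -mulrDr ler_wpM2l//.
  rewrite (le_trans (ler_normD _ _))// lerD2l (le_trans (cnormM _ _))//.
  rewrite -[leRHS]mulr1 ler_pM//; exact/ltW/(le_lt_trans ih).
have us n : cstar (u n) = u n.
  elim: n => [|n ih]; first exact: cstar0.
  rewrite /u iterS -/(u n) /T cstarZ cstarD cstarM ds ih.
  by rewrite [Num.conj _]geC0_conj// ltW.
have step n : `|u n - u n.+1| <= r ^+ n.
  elim: n => [|n ih].
    by rewrite expr0 sub0r normrN (le_trans (ur _))// ltW.
  rewrite /u !iterS -!/(u _) (le_trans (TB _ _))// exprS ler_pM//.
    by rewrite mulr_ge0// addr_ge0.
  by rewrite -[leRHS]mul1r -hr mulrDl -mulrDr ler_wpM2l// lerD//; exact: (ur n.+1).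
have r10 : 0 < 1 - r by rewrite subr_gt0.
have tail n m : (1 - r) * `|u n - u (n + m)%N| <= r ^+ n.
  suff : (1 - r) * `|u n - u (n + m)%N| <= r ^+ n * (1 - r ^+ m).
    by move/le_trans; apply; rewrite ler_piMr ?exprn_ge0// gerBl exprn_ge0.
  elim: m => [|m ih]; first by rewrite addn0 !subrr normr0 !mulr0.
  rewrite addnS (le_trans (ler_wpM2l (ltW r10) (ler_distD (u (n + m)%N) _ _)))//.
  rewrite mulrDr (le_trans (lerD ih (ler_wpM2l (ltW r10) (step _))))//.
  by rewrite le_eqVlt; apply/orP; left; apply/eqP; rewrite exprD exprS; ring.
have /cvg_ex[/= c uc] : cvg (u n @[n --> \oo]).
  apply: cauchy_cvg; apply: cauchy_exP => e e0.
  have : 0 < (1 - r) * e by rewrite mulr_gt0.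
  move=> /(near_expr_small r0 d1)[n _ nP].
  exists (u n); exists n => // m /= nm.
  rewrite -ball_normE /= -(ltr_pM2l r10) -(subnKC nm).
  by rewrite (le_lt_trans (tail _ _))// nP/=.
have ucS : u n.+1 @[n --> \oo] --> c by rewrite (cvg_shiftS u).
exists c.
  apply/eqP; rewrite -subr_eq0; apply/eqP.
  apply: (@eq0_small _ _ 2) => // e e0.
  move/cvgrPdist_lt : uc => /(_ _ e0)[n _ /(_ n)]/(_ (leqnn n)) ucn.
  exists `|c - u n| => //.
  rewrite -(subrK (u n) (cstar c)) -addrA (le_trans (ler_normD _ _))//.
  rewrite -{1}(us n) -cstarN -cstarD cnorm_starE [`|u n - c|]distrC.
  by rewrite mulr_natl mulr2n.
have Tc : T c - c = 0.
  have K0 : 0 < h * (`|c| + r) + 1.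
    by rewrite ltr_wpDl// mulr_ge0// addr_ge0.
  apply: (eq0_small K0) => e e0.
  move/cvgrPdist_lt : uc => /(_ _ e0) uc.
  move/cvgrPdist_lt : ucS => /(_ _ e0) ucS.
  near \oo => n.
  have cn : `|c - u n| < e by near: n.
  have cnS : `|c - u n.+1| < e by near: n.
  have le_max : exists2 w, w < e & `|c - u n| <= w /\ `|c - u n.+1| <= w.
    have [/= h1|h1] := real_leP (normr_real (c - u n)) (normr_real (c - u n.+1)).
      by exists `|c - u n.+1|.
    by exists `|c - u n| => //; split => //; exact: ltW.
  case: le_max => w we [w1 w2]; exists w => //.
  rewrite -(subrK (u n.+1) (T c)) -addrA (le_trans (ler_normD _ _))//.
  rewrite mulrDl mul1r lerD//; last by rewrite distrC.
  rewrite (le_trans (TB _ _))//.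
  apply: ler_pM => //; first by rewrite mulr_ge0// addr_ge0.
  by rewrite ler_wpM2l// lerD2l ur.
have /(congr1 (fun x => x *+ 2)) : T c = c by apply/eqP; rewrite -subr_eq0 Tc.
rewrite /T -scaler_nat scalerA mulfV ?pnatr_eq0// scale1r => <-.
by rewrite addrK.
Unshelve. all: by end_near. Qed.

Variable (phi : representation A).

Lemma rep0 x : phi 0 x = 0.
Proof.
have := rep_linear (r := phi) (-1) 0 0 x.
by rewrite scaler0 addr0 scaleN1r addNr.
Qed.

Lemma repD a b x : phi (a + b) x = phi a x + phi b x.
Proof. by have := rep_linear (r := phi) 1 a b x; rewrite !scale1r. Qed.

Lemma repZ k a x : phi (k *: a) x = k *: phi a x.
Proof. by have := rep_linear (r := phi) k a 0 x; rewrite rep0 !addr0. Qed.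

Lemma repB a b x : phi (a - b) x = phi a x - phi b x.
Proof. by rewrite repD -scaleN1r repZ scaleN1r. Qed.

Lemma rep_norm_le a x : `|a| < 1 -> `|phi a x| <= `|x|.
Proof.
move=> a1; rewrite -(@ler_pXn2r _ 2) ?nnegrE// !hnormE.
have [] := @cstar_sqrt (cmul (cstar a) a).
- by rewrite cstarM cstarK.
- by rewrite cnorm_star expr_lt1.
move=> c cs /(congr1 (fun d => hdot (phi d x) x)).
rewrite repM rep_star cstarK => ->.
have -> : hdot (phi (c *+ 2 - cmul c c) x) x =
    hdot x x - hdot (x - phi c x) (x - phi c x).
  rewrite repB mulr2n repD repM !linearBl /= !linearBr /= linearDl /=.
  rewrite (rep_star (r := phi) c x) cs.
  rewrite (rep_star (r := phi) c (phi c x)) cs.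
  ring.
by rewrite gerBl -hnormE exprn_ge0.
Qed.

Lemma rep_bounded a x : `|phi a x| <= 2 * `|a| * `|x|.
Proof.
have [->|a0] := eqVneq a 0; first by rewrite rep0 !normr0 mulr0 mul0r.
have a20 : 0 < 2 * `|a| by rewrite mulr_gt0 ?normr_gt0.
rewrite -ler_pdivrMl// -[X in X * _]gtr0_norm ?invr_gt0// -normrZ -repZ.
apply: rep_norm_le; rewrite normrZ gtr0_norm ?invr_gt0//.
by rewrite invfM -mulrA mulVf ?normr_eq0// mulr1 invf_lt1// ltr1n.
Qed.

Lemma closed_rep_ker : closed (rep_ker phi).
Proof.
move=> a /= cla x.
have K0 : 0 < 2 * `|x| + 1 by rewrite ltr_wpDl// mulr_ge0.
apply: (eq0_small K0) => e e0.
have /cla[b /= [kb]] : nbhs a (ball a e) by exact: nbhsx_ballx.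
rewrite -ball_normE /= => abe; exists `|a - b| => //.
rewrite -[phi a x]subr0 -(kb x) -repB (le_trans (rep_bounded _ _))//.
by rewrite [leRHS]mulrDl mul1r [leLHS]mulrAC lerDl.
Qed.

End rep_theory.

Section prim_topology.
Variables (R : realType) (A : cstarAlgType R).

Lemma closed_ideal_bigcap (T : Type) (P : set T) (J : T -> set A) :
  (forall t, P t -> closed_ideal (J t)) -> closed_ideal (\bigcap_(t in P) J t).
Proof.
move=> cJ; split; last first.
  by move=> a b Jb; split=> t Pt; have [_ /(_ a b (Jb t Pt))[]] := cJ t Pt.
split.
- by move=> t /cJ[[]].
- move=> k x y Jx Jy t Pt; have [[_ + _] _] := cJ t Pt.
  by apply; [exact: Jx|exact: Jy].
- by apply: closed_bigI => t /cJ[[]].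
Qed.

Lemma closed_idealT : closed_ideal [set: A].
Proof. by split=> //; split=> //; exact: closedT. Qed.

Lemma primitive_closed_ideal (I : set A) : primitive I -> closed_ideal I.
Proof.
move=> [pi _ ->]; split; first split.
- by move=> x; exact: rep0.
- by move=> k b c kb kc x; rewrite rep_linear kb kc scaler0 addr0.
- exact: closed_rep_ker.
- by move=> b c kc; split => x; rewrite repM ?kc ?linear0.
Qed.

Lemma prim_openT : prim_open [set: A] = setT.
Proof.
apply/seteqP; split=> // -[I [pi [[a [x pax]] pi_irr] Ipi]] IT /= TI.
have : I a by exact: TI.
by rewrite Ipi => /(_ x) /eqP; exact/negP.
Qed.

Lemma primitive_prime (I J1 J2 : set A) : primitive I ->
  closed_ideal J1 -> closed_ideal J2 ->
  J1 `&` J2 `<=` I -> J1 `<=` I \/ J2 `<=` I.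
Proof.
move=> [pi [_ pi_irr] ->] [_ J1i] [_ J2i] J12.
have [?|J2pi] := pselect (J2 `<=` rep_ker pi); [by right|left].
pose K : set (rep_space pi) := [set x | forall a, J1 a -> pi a x = 0].
have cK : closed_subspace K.
  split.
  - by move=> a _; rewrite linear0.
  - by move=> k x y Kx Ky a J1a; rewrite linearP Kx// Ky// scaler0 addr0.
  - move=> x clx a J1a.
    have K0 : 0 < 2 * `|a| + 1 by rewrite ltr_wpDl// mulr_ge0.
    apply: (eq0_small K0) => e e0.
    have /clx[y /= [Ky]] : nbhs x (ball x e) by exact: nbhsx_ballx.
    rewrite -ball_normE /= => xye; exists `|x - y| => //.
    rewrite -[pi a x]subr0 -(Ky a J1a) -linearB (le_trans (rep_bounded _ _))//.
    by rewrite [leRHS]mulrDl mul1r lerDl.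
have [] := pi_irr K cK.
- by move=> a x Kx b J1b; rewrite -repM; apply: Kx; have [] := J1i a b J1b.
- move=> K0; exfalso; apply: J2pi => b J2b y.
  suff : K (pi b y) by rewrite K0.
  move=> a J1a; rewrite -repM; apply: J12; split.
    by have [] := J1i b a J1a.
  by have [] := J2i a b J2b.
- by move=> KT a J1a x; have Kx : K x; [rewrite KT|exact: Kx].
Qed.

Lemma prim_openI (J1 J2 : set A) : closed_ideal J1 -> closed_ideal J2 ->
  prim_open J1 `&` prim_open J2 = prim_open (J1 `&` J2).
Proof.
move=> cJ1 cJ2; apply/seteqP; split => -[I pI] /=.
  by move=> [J1I J2I] J12; have [] := primitive_prime pI cJ1 cJ2 J12.
by move=> J12; split => JI; apply: J12 => a [J1a J2a]; exact: JI.
Qed.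

Let op : set (set (Prim A)) :=
  [set U | exists2 J : set A, closed_ideal J & U = prim_open J].

Let opT : op setT.
Proof. by exists setT; [exact: closed_idealT|rewrite prim_openT]. Qed.

Let opI : setI_closed op.
Proof.
move=> _ _ [J1 cJ1 ->] [J2 cJ2 ->].
exists (J1 `&` J2); last exact: prim_openI.
rewrite -bigcap2E; apply: closed_ideal_bigcap => -[|[|n]] //= _.
Qed.

Let op_bigU (T : Type) (f : T -> set (Prim A)) :
  (forall t, op (f t)) -> op (\bigcup_t f t).
Proof.
move=> opf.
have /choice[J JP] : forall t, exists J, closed_ideal J /\ f t = prim_open J.
  by move=> t; have [J] := opf t; exists J.
pose P : set (set A) := [set K | closed_ideal K /\ forall t, J t `<=` K].
exists (\bigcap_(K in P) K); first by apply: closed_ideal_bigcap => K [].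
apply/seteqP; split => -[I pI] /=.
  move=> [t _]; rewrite (JP t).2 /= => JI PI; apply: JI => a Ja.
  by apply: PI => K [_ /(_ t)]; exact.
move=> PI; apply: contrapT => JI; apply: PI => a; apply.
split=> [|t]; last first.
  apply: contrapT => JtI; apply: JI; exists t => //.
  by rewrite (JP t).2.
exact: primitive_closed_ideal.
Qed.

HB.instance Definition _ := gen_eqMixin (Prim A).
HB.instance Definition _ := gen_choiceMixin (Prim A).
HB.instance Definition _ := isOpenTopological.Build (Prim A) opT opI op_bigU.

Lemma prim_openP (U : set (Prim A)) :
  open U <-> exists2 J : set A, closed_ideal J & U = prim_open J.
Proof. by []. Qed.

End prim_topology.

Definition separable_space (T : topologicalType) : Prop :=
  exists2 D : set T, countable D & dense D.

Definition countable_nbhs_base (T : topologicalType) (x : T) : Prop :=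
  exists B : set (set T), [/\ countable B, B `<=` nbhs x &
    forall U, nbhs x U -> exists2 V, B V & V `<=` U].

(* Sets of representations are predicates here and below: the type of all
   representations is too large for the library's [set]. *)
Definition strictly_norming (R : realType) (A : cstarAlgType R)
    (F : representation A -> Prop) : Prop :=
  (unital A -> forall a : A, exists2 phi, F phi & `|a| = opnorm (phi a)) /\
  (forall (nuA : ~ unital A) (a : A) (k : R[i]),
    (exists2 phi, F phi &
      `|k *: unitU nuA + inU nuA a| = opnorm (fun x => k *: x + phi a x)) \/
    `|k *: unitU nuA + inU nuA a| = `|k|).

Definition exhausting (R : realType) (A : cstarAlgType R)
    (F : representation A -> Prop) : Prop :=
  forall pi : representation A, irreducible pi ->
    exists2 phi, F phi & rep_ker phi `<=` rep_ker pi.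

(* Main.v *)
Require Import Defs.
From HB Require Import structures.
From mathcomp Require Import all_boot all_order all_algebra.
From mathcomp Require Import sesquilinear complex ring lra.
From mathcomp Require Import boolp classical_sets functions cardinality reals.
From mathcomp Require Import topology normedtype sequences.

Set Implicit Arguments.
Unset Strict Implicit.
Unset Printing Implicit Defensive.

Import Order.TTheory GRing.Theory Num.Theory.
Import numFieldNormedType.Exports.

Local Open Scope classical_set_scope.
Local Open Scope ring_scope.
Local Open Scope complex_scope.

(** Notation: [phi] ranges over all representations of [A], and [phi]
    _contracts_ [d] when [phi d] has operator norm at most 1.

    Both halves rest on a cutoff (lemma [cutoff]). Put [y = z z*]. Then there
    is [g] in [A], a right multiple of [z], which plays the role of [(y - 1)_+]
    and hence is killed by exactly those representations that contract [z*].
    With it comes an [x] of norm at most 1, again a right multiple of [z], with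
    [x g = g]. The functional calculus that this takes is explicit.
    The square root of [1 - d] exists for every self-adjoint [d] of norm at most
    1, including norm 1 ([cstar_sqrt_le1]), so that in a unital algebra [|w|]
    and its square root exist for self-adjoint [w] ([abs_sqrt]). With
    [w = 1 - y], the elements [2 g = |w| - w] and [2 n = |w| + w] satisfy
    [n g = 0], and [x = (1 - n^2) / (1 + n^2)] is the real part of a unitary.
    If [A] has no unit this is done in its unitization, of which [A] is an
    ideal.

    Given [d], let [cutoff_ideal d] be the ideal of all elements killed by every
    representation that contracts [d]; it lies in [ker phi] exactly when [phi]
    contracts [d], by the cutoff. Let [D] be a countable dense set. If a
    representation [pi] does not kill [a], then some [d] in [D] close to a large
    multiple of [a] is not contracted by [pi], but is contracted by every
    representation that kills [a] ([cutoff_ideal_dense]). So the countably many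
    open sets defined by the ideals [cutoff_ideal d] contain a base at each
    point of [Prim A].

    For the second half, let [I = ker pi] with [pi] irreducible, and let
    [L_0, L_1, ...] enumerate the ideals [cutoff_ideal d], [d] in [D], that are
    not contained in [I]. If [ker phi] is not contained in [I], then [ker phi]
    contains some [L_n]. As [I] is prime, the cutoff can be applied again and
    again and yields [x_n] in [L_n] of norm at most 1 and [h_n <> 0] with
    [x_k h_n = h_n] for all [k < n] ([peak], [peak_sequence]). The element
    [a = sum_n 2^-(n+1) x_n] has norm at least 1, as seen on the [h_n], whereas
    [|phi a| <= 1 - 2^-(n+1)] as soon as [phi] kills [L_n]. If no [phi] in a
    strictly norming set had its kernel contained in [I], then the norm of [a]
    would not be attained on that set. *)

(** * Sequences dominated by a bounded real sequence *)

Section limits.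
Variables (R : realType) (V : completeNormedModType R[i]).

(** Besides the limit, the rate of convergence is controlled by [t]; the bound
    [M] need not be the limit of [t]. *)
Lemma dominated_cvg (u : nat -> V) (t : nat -> R) (M : R) :
  (forall n, `|u n.+1 - u n| <= (t n.+1 - t n)%:C) -> (forall n, t n <= M) ->
  exists l : V,
    (forall e : R[i], 0 < e ->
       exists n, forall m, (n <= m)%N -> `|l - u m| < e) /\
    forall n, `|l - u n| <= (M - t n)%:C.
Proof.
move=> ut tM.
have diff n k : `|u (n + k)%N - u n| <= (t (n + k)%N - t n)%:C.
  elim: k => [|k ih]; first by rewrite addn0 !subrr normr0.
  rewrite addnS -(subrKA (u (n + k)%N)) -(subrKA (t (n + k)%N)) rmorphD /=.
  by rewrite (le_trans (ler_normD _ _))// lerD.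
have t_nd : nondecreasing_seq t.
  apply/nondecreasing_seqP => n; rewrite -subr_ge0 -ler0c.
  by rewrite (le_trans _ (ut n)).
have tcvg : cvgn t.
  by apply: nondecreasing_is_cvgn => //; exists M => _ [n _ <-].
have t_small (e : R[i]) : 0 < e -> \forall n \near \oo,
    forall k, (t (n + k)%N - t n)%:C < e.
  move=> e0; have eE : e = (complex.Re e)%:C by exact/ge0_complexRe/ltW.
  have re0 : 0 < complex.Re e by rewrite -ltcR -eE.
  move/cvgrPdist_lt : (tcvg) => /(_ _ re0); apply: filterS => n tn k.
  rewrite eE ltcR (le_lt_trans _ tn)// (le_trans _ (ler_norm _))//.
  by rewrite lerD2r; exact: nondecreasing_cvgn_le.
have /cvg_ex[/= l ul] : cvg (u n @[n --> \oo]).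
  apply: cauchy_cvg; apply: cauchy_exP => e /t_small[n _ /(_ _ (leqnn n)) nP].
  exists (u n); exists n => // m /= nm.
  by rewrite -ball_normE /= distrC -(subnKC nm) (le_lt_trans (diff _ _)).
have near_l (e : R[i]) : 0 < e -> \forall n \near \oo, `|l - u n| < e.
  by move=> e0; move/cvgrPdist_lt : ul => /(_ _ e0).
exists l; split=> [e /near_l[n _ nP]|n]; first by exists n.
apply/ler_addgt0Pr => e /near_l[m _ mP].
have lm := mP (n + m)%N (leq_addl _ _).
rewrite -(subrKA (u (n + m)%N)) (le_trans (ler_normD _ _))// addrC.
rewrite lerD ?(ltW lm)// (le_trans (diff _ _))// lecR lerD2r; exact: tM.
Qed.

End limits.

(** * Square roots in a C*-algebra *)

Section sqrt.
Variables (R : realType) (A : cstarAlgType R).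

Lemma cmul_comm_lim (v c : A) :
  (forall e : R[i], 0 < e -> exists2 d, `|c - d| < e & cmul v d = cmul d v) ->
  cmul v c = cmul c v.
Proof.
move=> cv; apply/eqP; rewrite -subr_eq0; apply/eqP.
apply: (@eq0_small _ _ _ (`|v| + `|v| + 1)) => [|e /cv[d cd vd]].
  by rewrite ltr_wpDl// addr_ge0.
exists `|c - d| => //.
have -> : cmul v c - cmul c v = cmul v (c - d) - cmul (c - d) v.
  by rewrite cmulDr cmulDl cmulNr cmulNl vd opprB addrA subrK.
rewrite (le_trans (ler_normB _ _))//.
rewrite (le_trans (lerD (cnormM _ _) (cnormM _ _)))//.
by rewrite [X in _ + X]mulrC -mulrDl ler_wpM2r// lerDl.
Qed.

(** [1 - c] is a square root of [1 - d]. The iteration [c -> (d + c^2) / 2] from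
    0 has nonnegative coefficients in [d], so it is dominated by the same
    iteration for the number 1, which increases to 1. Hence it converges even
    when the norm of [d] is 1. *)
Lemma cstar_sqrt_le1 (d : A) : cstar d = d -> `|d| <= 1 ->
  exists c : A, [/\ cstar c = c, `|c| <= 1, d = c *+ 2 - cmul c c &
    forall v, cmul v d = cmul d v -> cmul v c = cmul c v].
Proof.
move=> ds d1.
pose h : R[i] := 2^-1; pose T (c : A) := h *: (d + cmul c c).
have h0 : 0 < h by rewrite invr_gt0.
have h0' : 0 <= h by exact: ltW.
have hr : h + h = 1 by rewrite [RHS]splitr mul1r.
have hE : h = (2^-1 : R)%:C by rewrite fmorphV rmorph_nat.
have TB c c' : `|T c - T c'| <= h * (`|c| + `|c'|) * `|c - c'|.
  rewrite -scalerBr opprD addrACA subrr add0r normrZ gtr0_norm// -mulrA.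
  rewrite ler_wpM2l//.
  have -> : cmul c c - cmul c' c' = cmul c (c - c') + cmul (c - c') c'.
    by rewrite cmulDr cmulDl cmulNr cmulNl addrA subrK.
  rewrite (le_trans (ler_normD _ _))// mulrDl lerD ?cnormM//.
  by rewrite mulrC cnormM.
pose u n := iter n T 0; pose t n : R := iter n (fun s => 2^-1 * (1 + s * s)) 0.
have uS n : u n.+1 = T (u n) by [].
have tS n : t n.+1 = 2^-1 * (1 + t n * t n) by [].
have t01 n : 0 <= t n /\ t n <= 1.
  by elim: n => [|n [t0 t1]]; [rewrite /t/=; lra|rewrite tS; nra].
have ut n : `|u n| <= (t n)%:C.
  elim: n => [|n ih]; first by rewrite normr0.
  rewrite uS tS normrZ gtr0_norm// rmorphM /= -hE ler_wpM2l// rmorphD/= rmorphM.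
  rewrite (le_trans (ler_normD _ _))// lerD// (le_trans (cnormM _ _))//.
  by rewrite ler_pM.
have u1 n : `|u n| <= 1 by rewrite (le_trans (ut n))// lecR; case: (t01 n).
have step n : `|u n.+1 - u n| <= (t n.+1 - t n)%:C.
  elim: n => [|n ih]; first by rewrite !subr0 (ut 1%N).
  rewrite uS {2}uS (le_trans (TB _ _))//.
  have -> : t n.+2 - t n.+1 = 2^-1 * (t n.+1 + t n) * (t n.+1 - t n).
    by rewrite (tS n.+1) (tS n); field.
  rewrite rmorphM ler_pM//; first by rewrite mulr_ge0// addr_ge0.
  rewrite rmorphM /= -hE ler_wpM2l// rmorphD lerD//; exact: (ut n.+1).
have [c [cu _]] := dominated_cvg step (fun n => (t01 n).2).
have approx : forall e : R[i], 0 < e ->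
    exists2 n, `|c - u n| < e & `|c - u n.+1| < e.
  by move=> e /cu[n cn]; exists n; apply: cn.
have c1 : `|c| <= 1.
  apply/ler_addgt0Pr => e /approx[n cn _].
  by rewrite -(subrK (u n) c) (le_trans (ler_normD _ _))// addrC lerD// ltW.
exists c; split=> //.
- apply/eqP; rewrite -subr_eq0; apply/eqP.
  apply: (@eq0_small _ _ _ 2) => // e /approx[n cn _].
  have us : cstar (u n) = u n.
    elim: (n) => [|m ih]; first exact: cstar0.
    by rewrite uS /T cstarZ cstarD cstarM ds ih [Num.conj _]geC0_conj.
  exists `|c - u n| => //.
  rewrite -(subrKA (u n)) (le_trans (ler_normD _ _))//.
  rewrite -{1}us -cstarN -cstarD cnorm_starE [`|u n - c|]distrC.
  by rewrite mulr_natl mulr2n.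
- have Tc : T c - c = 0.
    apply: (@eq0_small _ _ _ 1) => // e e0.
    have [n cn cnS] : exists2 n, `|c - u n| < e / 2 & `|c - u n.+1| < e / 2.
      by apply: approx; rewrite divr_gt0.
    exists (`|c - u n| + `|c - u n.+1|); first by rewrite [e]splitr ltrD.
    rewrite mul1r -(subrKA (u n.+1)) (le_trans (ler_normD _ _))//.
    rewrite [`|u n.+1 - c|]distrC lerD// uS (le_trans (TB _ _))// ler_piMl//.
    by rewrite (le_trans (ler_wpM2l h0' (lerD c1 (u1 n))))// mulrDr mulr1 hr.
  have /(congr1 (fun x => x *+ 2)) : T c = c by apply/eqP; rewrite -subr_eq0 Tc.
  rewrite /T -scaler_nat scalerA mulfV ?pnatr_eq0// scale1r => <-.
  by rewrite addrK.
- move=> v vd; apply: cmul_comm_lim => e /approx[n cn _]; exists (u n) => //.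
  elim: (n) => [|m ih]; first by rewrite cmul0l cmul0r.
  by rewrite uS /T cmulZl cmulZr cmulDl cmulDr vd cmulA ih -cmulA ih cmulA.
Qed.

End sqrt.

(** * Functional calculus in a unital C*-algebra *)

Section unital_ring.
Variables (R : realType) (B : cstarAlgType R) (e : B).

(** A C*-algebra with unit [e], as a ring. Triviality is not excluded: [e] may
    be 0. *)
Definition unital_ring
  (eP : forall b : B, cmul e b = b /\ cmul b e = b) : Type := B.

Variable eP : forall b : B, cmul e b = b /\ cmul b e = b.
Local Notation U := (unital_ring eP).

HB.instance Definition _ := CStarAlgebra.copy U B.

Let emul : left_id e (@cmul R B). Proof. by move=> b; have [] := eP b. Qed.
Let mule : right_id e (@cmul R B). Proof. by move=> b; have [] := eP b. Qed.
HB.instance Definition _ := GRing.Zmodule_isPzRing.Build U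
  (@cmulA R B) emul mule (@cmulDl R B) (@cmulDr R B).

Implicit Types (a b c u v w y : U) (k : R[i]).

Let mulZl k a b : (k *: a) * b = k *: (a * b). Proof. exact: cmulZl. Qed.
Let mulZr k a b : a * (k *: b) = k *: (a * b). Proof. exact: cmulZr. Qed.
Let starM a b : cstar (a * b) = cstar b * cstar a. Proof. exact: cstarM. Qed.
Let norm_star a : `|cstar a * a| = `|a| ^+ 2. Proof. exact: cnorm_star. Qed.
Let norm_sq a : cstar a = a -> `|a * a| = `|a| ^+ 2.
Proof. by move=> sa; rewrite -norm_star sa. Qed.

Lemma cstar1 : cstar (1 : U) = 1.
Proof.
rewrite -[LHS]mulr1 -[X in _ * X]cstarK -starM.
by rewrite mulr1 cstarK.
Qed.

Lemma cnorm1_le : `|1 : U| <= 1.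
Proof.
have [->|n0] := eqVneq `|1 : U| 0; first exact: ler01.
suff -> : `|1 : U| = 1 by [].
by apply: (mulfI n0); rewrite -expr2 -norm_sq ?cstar1// !mulr1.
Qed.

(** [a] is the real part of the unitary [a + i b]. *)
Lemma sqr_sum1_norm a b : cstar a = a -> cstar b = b -> GRing.comm a b ->
  a * a + b * b = 1 -> `|a| <= 1.
Proof.
move=> sa sb ab ab1; pose w := a + 'i%R *: b.
have sw : cstar w = a - 'i%R *: b.
  by rewrite cstarD cstarZ sa sb conjCi scaleNr.
have w1 : `|w| <= 1.
  have ii : 'i%R * 'i%R = -1 :> R[i] by rewrite -expr2 sqrCi.
  rewrite -(@expr_le1 _ 2)// -norm_star sw mulrBl !mulrDr mulZr !mulZl mulZr.
  rewrite scalerA ii scaleN1r ab opprB addrACA subrr addr0.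
  by rewrite ab1 cnorm1_le.
have -> : a = 2^-1 *: (w + cstar w).
  have hr : 2^-1 + 2^-1 = 1 :> R[i] by rewrite [RHS]splitr mul1r.
  by rewrite sw addrACA subrr addr0 scalerDr -scalerDl hr scale1r.
rewrite normrZ ger0_norm ?invr_ge0// ler_pdivrMl// mulr1.
by rewrite (le_trans (ler_normD _ _))// cnorm_starE lerD.
Qed.

Lemma sqrt_1sub (d : U) : cstar d = d -> `|d| <= 1 ->
  exists c : U, [/\ cstar c = c, `|c| <= 1, (1 - c) * (1 - c) = 1 - d &
    forall v, GRing.comm v d -> GRing.comm v c].
Proof.
move=> sd d1; have [c [sc c1 dE vc]] := @cstar_sqrt_le1 R U d sd d1.
exists c; split=> //.
rewrite dE -[cmul c c]/(c * c) mulrBl mul1r mulrBr mulr1 mulr2n.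
by rewrite -addrA -opprD addrA.
Qed.

Lemma sub1_sq_norm v : cstar v = v -> `|v| <= 1 -> `|1 - v * v| <= 1.
Proof.
move=> sv v1.
have [||c [sc c1 a2 vc]] := @sqrt_1sub (v * v).
- by rewrite starM sv.
- by rewrite norm_sq// expr_le1.
have sa : cstar (1 - c) = 1 - c by rewrite cstarD cstarN cstar1 sc.
rewrite -a2 norm_sq ?expr_le1//.
apply: (@sqr_sum1_norm _ v) => //; last by rewrite a2 subrK.
apply/commr_sym/commrB; first exact: commr1.
by apply: vc; apply: commrM.
Qed.

(** The Neumann series. *)
Lemma sub1_inv (q : U) (rho : R) : 0 <= rho -> rho < 1 -> `|q| <= rho%:C ->
  exists r : U, [/\ (1 - q) * r = 1, r * (1 - q) = 1 &
    forall v, GRing.comm v q -> GRing.comm v r].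
Proof.
move=> rho0 rho1 qrho.
pose u n := iter n (fun b : U => 1 + q * b) 0.
pose t n := iteri n (fun i s => s + rho ^+ i) 0.
have uS n : u n.+1 = 1 + q * u n by [].
have tS n : t n.+1 = t n + rho ^+ n by [].
have step n : `|u n.+1 - u n| <= (t n.+1 - t n)%:C.
  rewrite tS [t n + _]addrC addrK; elim: n => [|n ih].
    by rewrite expr0 uS mulr0 addr0 subr0 cnorm1_le.
  rewrite uS {2}uS opprD addrACA subrr add0r -mulrBr exprS rmorphM.
  by rewrite (le_trans (cnormM _ _))// ler_pM.
have tM n : t n <= (1 - rho)^-1.
  have tE : (1 - rho) * t n = 1 - rho ^+ n.
    elim: n => [|n ih]; first by rewrite /t /= mulr0 expr0 subrr.
    by rewrite tS mulrDr ih exprS; ring.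
  rewrite -[leRHS]mulr1 ler_pdivlMl ?subr_gt0// tE gerBl exprn_ge0//.
have [r [ru _]] := dominated_cvg step tM.
have rE : r = 1 + q * r.
  apply/eqP; rewrite -subr_eq0; apply/eqP.
  have K0 : 0 < 1 + `|q| by rewrite ltr_pwDl.
  apply: (eq0_small K0) => d d0.
  have d20 : 0 < d / 2 by rewrite divr_gt0.
  have [n nP] := ru _ d20.
  exists (`|r - u n.+1| + `|r - u n|).
    by rewrite [d]splitr ltrD// nP.
  have -> : r - (1 + q * r) = (r - u n.+1) - q * (r - u n).
    by rewrite uS mulrBr opprB !opprD -!addrA addKr.
  rewrite (le_trans (ler_normB _ _))// mulrDl mul1r -addrA lerD2l.
  rewrite (le_trans (cnormM _ _))// mulrDr addrA lerDr.
  by rewrite addr_ge0// mulr_ge0.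
have rcomm v : GRing.comm v q -> GRing.comm v r.
  move=> vq; apply: (@cmul_comm_lim R U) => d /ru[n /(_ _ (leqnn n)) rn].
  exists (u n) => //; rewrite -[LHS]/(v * u n) -[RHS]/(u n * v).
  elim: (n) => [|m ih]; first by rewrite mul0r mulr0.
  by rewrite uS mulrDl mulrDr mul1r mulr1 mulrA vq -mulrA ih mulrA.
have r1 : (1 - q) * r = 1 by rewrite mulrBl mul1r {1}rE addrK.
exists r; split=> //; rewrite -(rcomm (1 - q))//.
by apply/commr_sym/commrB; first exact: commr1.
Qed.

(** [1 + k (1 - u)] is [1 + k] times [1 - (k / (1 + k)) u]. *)
Lemma add1_inv u k : cstar u = u -> `|u| <= 1 -> 0 <= k ->
  exists r : U, [/\ cstar r = r, (1 + k *: (1 - u)) * r = 1,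
    r * (1 + k *: (1 - u)) = 1 &
    forall v, GRing.comm v u -> GRing.comm v r].
Proof.
move=> su u1 k0; have k10 : 0 < 1 + k by rewrite ltr_pwDl.
have k1n0 : 1 + k != 0 by rewrite gt_eqF.
pose rho := complex.Re (k / (1 + k)).
have rhoE : rho%:C = k / (1 + k).
  by rewrite -ge0_complexRe// divr_ge0// ltW.
have [|||r [r1 r2 rc]] := @sub1_inv ((k / (1 + k)) *: u) rho.
- by rewrite -ler0c rhoE divr_ge0// ltW.
- by rewrite -ltcR rhoE ltr_pdivrMr// mul1r ltrDr.
- rewrite normrZ rhoE ger0_norm ?divr_ge0 ?(ltW k10)//.
  by rewrite ler_piMr// divr_ge0// ltW.
have DE : 1 + k *: (1 - u) = (1 + k) *: (1 - (k / (1 + k)) *: u).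
  rewrite [RHS]scalerBr scalerA mulrCA mulfV// mulr1 scalerDl scale1r scalerBr.
  by rewrite addrA.
exists ((1 + k)^-1 *: r).
have inv1 : (1 + k *: (1 - u)) * ((1 + k)^-1 *: r) = 1.
  by rewrite DE mulZl mulZr scalerA mulfV// scale1r.
have inv2 : ((1 + k)^-1 *: r) * (1 + k *: (1 - u)) = 1.
  by rewrite DE mulZl mulZr scalerA mulVf// scale1r.
split=> //.
  set D := 1 + k *: (1 - u) in inv1 *; set s := _ *: r in inv1 *.
  have sD : cstar D = D.
    by rewrite cstarD cstarZ cstarD cstarN cstar1 su [Num.conj _]geC0_conj.
  (* left and right inverses of D coincide *)
  by rewrite -[LHS]mulr1 -inv1 mulrA -{1}sD -starM inv1 cstar1 mul1r.
move=> v vu; rewrite /GRing.comm mulZl mulZr rc//.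
by rewrite /GRing.comm mulZl mulZr vu.
Qed.

(** [s * s] is the absolute value of [w]; its form [k *: (1 - u)] makes
    [1 + s * s] invertible. *)
Lemma abs_sqrt w : cstar w = w -> exists (s u : U) k,
  [/\ cstar s = s, (s * s) * (s * s) = w * w,
      [/\ cstar u = u, `|u| <= 1, 0 <= k & s * s = k *: (1 - u)] &
      forall v, GRing.comm v w -> GRing.comm v s].
Proof.
move=> sw; pose k := `|w| + 1.
have k0 : 0 < k by rewrite ltr_wpDl.
have kn0 : k != 0 by rewrite gt_eqF.
pose v := k^-1 *: w.
have ck : Num.conj k^-1 = k^-1 by rewrite geC0_conj// invr_ge0 ltW.
have sv : cstar v = v by rewrite cstarZ sw ck.
have v1 : `|v| <= 1.
  by rewrite normrZ gtr0_norm ?invr_gt0// ler_pdivrMl// mulr1 lerDl.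
have [||u [su u1 uE uc]] := @sqrt_1sub (1 - v * v).
- by rewrite cstarD cstarN cstar1 starM sv.
- exact: sub1_sq_norm.
have [c [sc c1 cE cc]] := sqrt_1sub su u1.
exists (sqrtC k *: (1 - c)), u, k.
have ssE : (sqrtC k *: (1 - c)) * (sqrtC k *: (1 - c)) = k *: (1 - u).
  by rewrite mulZl mulZr scalerA -expr2 sqrtCK cE.
split=> //; last 2 first.
- by split=> //; exact: ltW.
- move=> a aw; rewrite /GRing.comm mulZl mulZr; congr (_ *: _).
  apply: commrB; first exact: commr1.
  apply/cc/uc/commrB; first exact: commr1.
  have av : GRing.comm a v by rewrite /GRing.comm mulZl mulZr aw.
  exact: commrM.
- rewrite cstarZ cstarD cstarN cstar1 sc [Num.conj _]geC0_conj//.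
  by rewrite sqrtC_ge0 ltW.
- rewrite ssE mulZl mulZr scalerA uE subKr mulZl mulZr scalerA scalerA.
  rewrite (_ : k * k * _ * _ = 1) ?scale1r//.
  by rewrite -mulrA mulrACA mulfV// mulr1.
Qed.

(** With [w = 1 - y], [m = |w| = s^2] and [n = (|w| + w) / 2], the elements are
    [g = (|w| - w) / 2], [x = (1 - n^2) / (1 + n^2)], [p = s g] and [q = s y].
    The last three equations express the positivity of [|w|] as identities
    between elements of every ideal that contains [y]. *)
Lemma cutoff_unital y : cstar y = y -> exists g x p q : U,
  [/\ exists b, g = y * b, exists b, x = y * b,
     exists b, p = y * b & exists b, q = y * b] /\
  [/\ [/\ cstar g = g, cstar p = p & cstar q = q],
     `|x| <= 1, x * g = g &
  [/\ g * y * g - g * g = p * p, g * g * g = p * p &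
    y * (g + g) * y = q * q - y * y + y * y * y]].
Proof.
move=> sy; have [w wE] : exists w, w = 1 - y by exists (1 - y).
have sw : cstar w = w by rewrite wE cstarD cstarN cstar1 sy.
have yw : GRing.comm y w by rewrite wE; apply: commrB => //; exact: commr1.
have [s [u [k [ss ssw [su u1 k0 suE] sc]]]] := abs_sqrt sw.
have ys : GRing.comm y s := sc _ yw.
have ws : GRing.comm w s by exact: sc.
pose m := s * s.
have sm : cstar m = m by rewrite starM ss.
have ym : GRing.comm y m by exact: commrM.
have wm : GRing.comm w m by exact: commrM.
have [r [sr mr rm rc]] := add1_inv su u1 k0.
rewrite -suE -/m in mr rm.
have hr : 2^-1 + 2^-1 = 1 :> R[i] by rewrite [RHS]splitr mul1r.
have ch : Num.conj 2^-1 = 2^-1 :> R[i] by rewrite geC0_conj// invr_ge0.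
have [g gdef] : exists g, g = 2^-1 *: (m - w) by exists (2^-1 *: (m - w)).
have [n ndef] : exists n, n = 2^-1 *: (m + w) by exists (2^-1 *: (m + w)).
have sg : cstar g = g by rewrite gdef cstarZ cstarD cstarN sm sw ch.
have sn : cstar n = n by rewrite ndef cstarZ cstarD sm sw ch.
have g2 : g + g = m - w by rewrite gdef -scalerDl hr scale1r.
have n2 : n + n = m + w by rewrite ndef -scalerDl hr scale1r.
have nwg : n = w + g.
  rewrite -[in RHS](scale1r w) -hr scalerDl gdef ndef scalerBr addrACA.
  by rewrite subrr addr0 addrC -scalerDr.
have commh v a b : GRing.comm v a -> GRing.comm v b ->
    GRing.comm v (2^-1 *: (a + b)).
  by move=> va vb; rewrite /GRing.comm mulZl mulZr mulrDl mulrDr va vb.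
have commg v : GRing.comm v m -> GRing.comm v w -> GRing.comm v g.
  by move=> vm vw; rewrite gdef; apply: commh => //; exact: commrN.
have yg : GRing.comm y g by exact: commg.
have sgc : GRing.comm s g.
  by apply: commg; [exact: commrM|exact: commr_sym].
have ng : n * g = 0.
  rewrite ndef gdef mulZl mulZr mulrDl !mulrBr ssw wm addrA subrK subrr.
  by rewrite !scaler0.
have wg : w * g = - (m * g).
  by apply/eqP; rewrite -addr_eq0 addrC -mulrDl -n2 mulrDl ng addr0.
have myg : y * g = g + m * g.
  apply/esym/eqP; rewrite -subr_eq0 -addrA addrC -addrA [_ + g]addrC.
  by rewrite -{2}[g]mul1r -mulrBl -wE wg subrr.
have ggE : g * g = m * g.
  by rewrite {1}gdef mulZl mulrBl wg opprK scalerDr -scalerDl hr scale1r.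
(* (1 - m)(1 + m) = 1 - w^2 = y (1 + w) *)
have mE : 1 - m = y * ((1 + w) * r).
  rewrite mulrA -[LHS]mulr1 -[X in _ * X = _]mr mulrA; congr (_ * _).
  rewrite mulrDr mulr1 mulrBl mul1r addrA subrK ssw.
  have yE : y = 1 - w by rewrite wE subKr.
  by rewrite mulrDr mulr1 yE mulrBl mul1r addrA subrK.
have [b1 gE] : exists b, g = y * b.
  exists (2^-1 *: (1 - (1 + w) * r)).
  rewrite gdef mulZr mulrBr mulr1 -mE; congr (_ *: _).
  by rewrite wE !opprB addrCA.
have n1E : 1 - n = y * (1 - b1).
  rewrite mulrBr mulr1 -gE nwg opprD addrA; congr (_ - _).
  by rewrite wE subKr.
(* S is the inverse of 1 + n^2 = 1 + K^2 (1 - (1 - (n / K)^2)) *)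
pose K := `|n| + 1.
have K0 : 0 < K by rewrite ltr_wpDl.
have Kn0 : K != 0 by rewrite gt_eqF.
pose v := K^-1 *: n.
have cK : Num.conj K^-1 = K^-1 by rewrite geC0_conj// invr_ge0 ltW.
have sv : cstar v = v by rewrite cstarZ sn cK.
have v1 : `|v| <= 1.
  by rewrite normrZ gtr0_norm ?invr_gt0// ler_pdivrMl// mulr1 lerDl.
have svv : cstar (1 - v * v) = 1 - v * v.
  by rewrite cstarD cstarN cstar1 starM sv.
have [|S [sS]] := add1_inv svv (sub1_sq_norm sv v1) (_ : 0 <= K * K).
  by rewrite mulr_ge0// ltW.
rewrite subKr mulZl mulZr !scalerA (_ : K * K * (_ * _) = 1); last first.
  by rewrite mulrACA mulfV// mulr1.
rewrite scale1r => nS Sn Sc.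
have nSc : GRing.comm n S.
  apply: Sc; apply: commrB; first exact: commr1.
  by rewrite /GRing.comm mulZr mulZl mulrA.
pose x := (1 - n * n) * S.
exists g, x, (s * g), (y * s); split; split.
- by exists b1.
- exists ((1 - b1) * ((1 + n) * S)).
  rewrite mulrA -n1E mulrA; congr (_ * _).
  by rewrite mulrDr mulr1 mulrBl mul1r addrA subrK.
- by exists (b1 * s); rewrite sgc gE mulrA.
- by exists s.
- by split; rewrite // starM ss ?sg ?sy ?ys ?sgc.
(* x^2 + (2 n S)^2 = 1 *)
- pose b := (n + n) * S.
  have nZ : GRing.comm n (1 - n * n).
    by apply: commrB; [exact: commr1|exact: commrM].
  have SZ : GRing.comm S (1 - n * n).
    by apply: commrB; [exact: commr1|apply: commrM; exact: commr_sym].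
  have SP : GRing.comm (1 + n * n) S by rewrite /GRing.comm nS Sn.
  have Sn2 : GRing.comm (n + n) S by apply/commr_sym/commrD; exact: commr_sym.
  have xn : GRing.comm x n by apply/commr_sym/commrM.
  have xS : GRing.comm x S by apply/commr_sym/commrM.
  have sqM a : GRing.comm a S -> (a * S) * (a * S) = (a * a) * (S * S).
    by move=> c; rewrite -mulrA (mulrA S) -c !mulrA.
  apply: (@sqr_sum1_norm x b).
  - by rewrite starM sS cstarD cstarN cstar1 starM sn SZ.
  - by rewrite starM sS cstarD sn -Sn2.
  - by apply: commrM => //; apply: commrD.
  - rewrite sqM; last exact: commr_sym.
    rewrite sqM// -mulrDl (_ : _ + _ = (1 + n * n) * (1 + n * n)).
      by rewrite -sqM// nS mulr1.
    rewrite mulrBl mul1r mulrBr mulr1 opprB !mulrDl !mulrDr !mul1r mulr1.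
    by rewrite addrACA !subrKA [n * n * (n * n) + _]addrC.
- have Sg : S * g = g.
    rewrite -[RHS]mul1r -Sn -mulrA mulrDl mul1r -[n * n * g]mulrA ng mulr0.
    by rewrite addr0.
  by rewrite -mulrA Sg mulrBl mul1r -[n * n * g]mulrA ng mulr0 subr0.
- have pp : (s * g) * (s * g) = m * (g * g).
    by rewrite -mulrA (mulrA g) -[g * s]sgc !mulrA.
  have gm : GRing.comm m g by apply: commg => //; exact: commr_sym.
  split.
  + rewrite pp -mulrA myg mulrDr addrC addKr mulrA -[g * m]gm.
    by rewrite mulrA.
  + by rewrite pp mulrA -ggE.
  + rewrite g2 wE opprB addrA mulrBr mulr1 mulrDr mulrBl mulrDl addrAC.
    congr (_ - _ + _).
    by rewrite -(mulrA y m) -ym -(mulrA y s) (mulrA s y) -ys /m !mulrA.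
Qed.

End unital_ring.

(** * Passage to an algebra without unit *)

Section nonunital.
Variables (R : realType) (A : cstarAlgType R).

Lemma cstar_inU (nuA : ~ unital A) a : cstar (inU nuA a) = inU nuA (cstar a).
Proof. by congr pair; rewrite /= conjC0. Qed.

(** [A] is a right ideal of its unitization. *)
Lemma cmul_inU_ideal (nuA : ~ unital A) a b :
  cmul (inU nuA a) b = inU nuA (cmul a b.1 + b.2 *: a).
Proof. by congr pair; rewrite /= ?scale0r ?addr0 ?mul0r. Qed.

Lemma unitUP (nuA : ~ unital A) b :
  cmul (unitU nuA) b = b /\ cmul b (unitU nuA) = b.
Proof.
by case: b => b k; split; congr pair;
  rewrite /= ?cmul0l ?cmul0r ?scaler0 ?scale1r ?add0r ?addr0 ?mul1r ?mulr1.
Qed.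

(** [cutoff_unital] with or without a unit: the right multiples of [y] in the
    unitization are the elements [cmul y b + k *: y]. *)
Lemma cutoff_selfadjoint (y : A) : cstar y = y -> exists g x p q : A,
  [/\ exists b k, g = cmul y b + k *: y & exists b k, x = cmul y b + k *: y] /\
  [/\ [/\ cstar g = g, cstar p = p & cstar q = q],
     `|x| <= 1, cmul x g = g &
  [/\ cmul (cmul g y) g - cmul g g = cmul p p, cmul (cmul g g) g = cmul p p &
    cmul (cmul y (g + g)) y = cmul q q - cmul y y + cmul (cmul y y) y]].
Proof.
move=> sy; have [[e eP]|nuA] := pselect (unital A).
  have [g [x [p [q [[[b gE] [c xE] _ _] gxpq]]]]] :=
    @cutoff_unital R A e eP y sy.
  exists g, x, p, q; split; last exact: gxpq.
  by split; [exists b|exists c]; exists 0; rewrite scale0r addr0.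
have sy' : cstar (inU nuA y) = inU nuA y by rewrite cstar_inU sy.
have [_ [_ [_ [_ [[[b ->] [c ->] [p ->] [q ->]]]]]]] :=
  @cutoff_unital R _ _ (@unitUP nuA) (inU nuA y) sy'.
rewrite /GRing.mul /= !cmul_inU_ideal.
set g' := _ + _; set p' := _ + _; set q' := _ + _; set x' := _ + _.
move=> [[sg sp sq] x1 xg [e1 e2 e3]].
exists g', x', p', q'.
split; first by split; [exists b.1, b.2|exists c.1, c.2].
(* identities between elements of [A], read off the first components *)
move: (congr1 fst sg) (congr1 fst sp) (congr1 fst sq) => /= {}sg {}sp {}sq.
move: (congr1 fst xg) (congr1 fst e1) (congr1 fst e2) (congr1 fst e3) => /=.
rewrite addr0 !scale0r !addr0 => *.
by split; [split|rewrite -(normr_inU nuA)| |split].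
Qed.

End nonunital.

(** * Representations *)

Section representations.
Variables (R : realType) (A : cstarAlgType R).
Implicit Types (phi : representation A) (a b z : A).

(** The factor [k] makes [k *: a] of norm less than 1 and would make
    [phi (k *: a) v] longer than [v]. *)
Lemma rep_norm phi a v : `|phi a v| <= `|a| * `|v|.
Proof.
apply: contrapT => /negP; rewrite -real_ltNge ?ger0_real ?mulr_ge0// => lt_av.
have [v0|v0] := eqVneq v 0.
  by move: lt_av; rewrite v0 linear0 !normr0 mulr0 ltxx.
have nv : 0 < `|v| by rewrite normr_gt0.
pose s := `|a| * `|v| + `|phi a v|.
have s0 : 0 < s.
  by rewrite ltr_wpDl ?mulr_ge0// (le_lt_trans _ lt_av)// mulr_ge0.
pose k := 2 * `|v| / s.
have k0 : 0 < k by rewrite divr_gt0// mulr_gt0.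
have := @rep_norm_le R A phi (k *: a) v.
rewrite repZ (normrZ k a) (normrZ k) (gtr0_norm k0) => le_kav.
suff : `|v| < `|v| by rewrite ltxx.
apply: (@lt_le_trans _ _ (k * `|phi a v|)); last first.
  apply: le_kav; rewrite mulrAC ltr_pdivrMr// mul1r.
  by rewrite -mulrA mulr_natl mulr2n [`|v| * _]mulrC ltrD2l.
rewrite mulrAC ltr_pdivlMr// -mulrA [ltRHS]mulrCA ltr_pM2l//.
by rewrite mulr_natl mulr2n ltrD2r.
Qed.

Lemma rep_eq0 phi a v : hdot (phi a v) (phi a v) = 0 -> phi a v = 0.
Proof. by rewrite -hnormE => /eqP; rewrite sqrf_eq0 normr_eq0 => /eqP. Qed.

Lemma rep_star_norm phi z v :
  `|phi (cstar z) v| ^+ 2 = hdot (phi (cmul z (cstar z)) v) v.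
Proof. by rewrite hnormE rep_star cstarK -repM rep_star cstarM !cstarK. Qed.

Lemma rep_ker_star phi a :
  (forall v, phi a v = 0) -> forall v, phi (cstar a) v = 0.
Proof.
move=> a0 v; apply/eqP; rewrite -normr_eq0 -sqrf_eq0 rep_star_norm repM a0.
by rewrite linear0l.
Qed.

Lemma sqr_norm_hdot (H : hilbertType R) (u v : H) (c : R[i]) :
  hdot u v = c -> hdot v u = c ->
  c *+ 2 <= `|u| ^+ 2 + `|v| ^+ 2.
Proof.
move=> uv vu; rewrite -subr_ge0.
suff -> : `|u| ^+ 2 + `|v| ^+ 2 - c *+ 2 = `|u - v| ^+ 2 by rewrite exprn_ge0.
rewrite !hnormE linearBl /= !linearBr /= uv vu mulr2n; ring.
Qed.

(** [phi a] has operator norm at most 1. *)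
Definition contracts phi a := forall v, `|phi a v| <= `|v|.

Lemma rep_hdot_sq phi a v w :
  hdot (phi (cmul (cstar a) a) v) w = hdot (phi a v) (phi a w).
Proof. by rewrite repM rep_star cstarK. Qed.

(** It suffices that [phi a] contracts the vectors [phi (a* a) v]. Indeed
    [|u - v|^2 >= 0] yields [2 |a* a v|^2 <= |a a* a v|^2 + |a v|^2] and
    [2 |a v|^2 <= |a* a v|^2 + |v|^2]. *)
Lemma contracts_of_cube phi a :
  (forall v, `|phi a (phi (cmul (cstar a) a) v)|
             <= `|phi (cmul (cstar a) a) v|) ->
  contracts phi a.
Proof.
set y := cmul (cstar a) a => Dy v; rewrite -(@ler_pXn2r _ 2) ?nnegrE//.
have ayv : `|phi a (phi y v)| ^+ 2 <= `|phi y v| ^+ 2.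
  by rewrite ler_pXn2r ?nnegrE.
have sy : cstar y = y by rewrite cstarM cstarK.
have sym u w : hdot u (phi y w) = hdot (phi y u) w by rewrite rep_star sy.
have h1 : hdot (phi y v) v = `|phi a v| ^+ 2 by rewrite rep_hdot_sq -hnormE.
have h2 : hdot (phi a (phi y v)) (phi a v) = `|phi y v| ^+ 2.
  by rewrite -rep_hdot_sq -/y -sym -hnormE.
have := sqr_norm_hdot h1 (etrans (sym _ _) h1).
have := sqr_norm_hdot h2 (etrans (esym (rep_hdot_sq _ _ _)) (esym (hnormE _))).
move=> /le_trans/(_ (lerD ayv (lexx _))).
rewrite mulr2n lerD2l => y_a /le_trans/(_ (lerD y_a (lexx _))).
by rewrite mulr2n lerD2l.
Qed.

(** The element [g] stands for [(z z* - 1)_+], and [x] is 1 where [g] does not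
    vanish. *)
Lemma cutoff z : exists g x : A,
  [/\ exists c, g = cmul z c, exists c, x = cmul z c, `|x| <= 1, cmul x g = g &
    forall phi, (forall v, phi g v = 0) <-> contracts phi (cstar z)].
Proof.
have [y yE] : exists y, y = cmul z (cstar z) by exists (cmul z (cstar z)).
have sy : cstar y = y by rewrite yE cstarM cstarK.
have [g [x [p [q [[[b [k gE]] [c [l xE]]]]]]]] := cutoff_selfadjoint sy.
move=> [[sg sp sq] x1 xg [gyg ggg ygy]].
have zy d m : cmul y d + m *: y = cmul z (cmul (cstar z) d + m *: cstar z).
  by rewrite yE cmulDr cmulZr cmulA.
exists g, x; split=> //.
- by eexists; rewrite gE; exact: zy.
- by eexists; rewrite xE; exact: zy.
have ydot phi v w : hdot (phi y v) w = hdot (phi (cstar z) v) (phi (cstar z) w).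
  by rewrite -rep_hdot_sq cstarK yE.
have sqn phi a v : cstar a = a -> hdot (phi (cmul a a) v) v = `|phi a v| ^+ 2.
  by move=> sa; rewrite hnormE repM rep_star sa.
move=> phi; split=> [g0|ctr].
  (* if phi kills g, then ygy gives |z* y v|^2 = |y v|^2 - |q v|^2 *)
  apply: contracts_of_cube => v; rewrite cstarK -yE.
  rewrite -(@ler_pXn2r _ 2) ?nnegrE// -subr_ge0.
  have /(congr1 (fun a => hdot (phi a v) v)) := ygy.
  rewrite /= [in LHS]repM [in LHS]repM repD !g0 addr0 linear0 linear0l.
  rewrite repD linearDl /= repB linearBl /=.
  rewrite !sqn// repM repM rep_star sy ydot -hnormE => e0.
  suff <- : `|phi q v| ^+ 2 = `|phi y v| ^+ 2 - `|phi (cstar z) (phi y v)| ^+ 2.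
    by rewrite exprn_ge0.
  by apply/eqP; rewrite -subr_eq0 opprB addrA addrAC -e0.
(* gyg gives |p v|^2 = |z* g v|^2 - |g v|^2; hence phi kills p and g^3 = p^2 *)
have p0 v : phi p v = 0.
  have pE : `|phi p v| ^+ 2 = `|phi (cstar z) (phi g v)| ^+ 2 - `|phi g v| ^+ 2.
    rewrite -sqn// -gyg repB linearBl /= sqn//.
    by rewrite !repM rep_star sg ydot -hnormE.
  apply/eqP; rewrite -normr_eq0 -sqrf_eq0 eq_le exprn_ge0// andbT pE subr_le0.
  by rewrite ler_pXn2r ?nnegrE// ctr.
have ggg0 v : phi (cmul (cmul g g) g) v = 0 by rewrite ggg repM p0.
have gg0 v : phi (cmul g g) v = 0.
  apply: rep_eq0; rewrite {2}[phi (cmul g g) v]repM -{3}sg -rep_star.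
  by rewrite -repM cmulA ggg0 linear0l.
by move=> v; apply: rep_eq0; rewrite rep_star sg -repM gg0 linear0r.
Qed.

(** * The cutoff ideals *)

Lemma rep_ker_closed_ideal phi : closed_ideal (rep_ker phi).
Proof.
split; first split.
- by move=> v; exact: rep0.
- by move=> k b c kb kc v; rewrite rep_linear kb kc scaler0 addr0.
- exact: closed_rep_ker.
- by move=> b c kc; split => v; rewrite repM ?kc ?linear0.
Qed.

(** The elements killed by every representation that contracts [a]. *)
Definition cutoff_ideal a : set A :=
  [set b | forall phi, contracts phi a -> forall v, phi b v = 0].

Lemma cutoff_ideal_closed a : closed_ideal (cutoff_ideal a).
Proof.
have -> : cutoff_ideal a = \bigcap_(K in
    [set K | exists2 phi, contracts phi a & K = rep_ker phi]) K.
  apply/seteqP; split=> b.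
    by move=> ba K [phi pa ->]; exact: ba.
  by move=> bK phi pa; apply: (bK (rep_ker phi)); exists phi.
by apply: closed_ideal_bigcap => K [phi _ ->]; exact: rep_ker_closed_ideal.
Qed.

Lemma cutoff_ideal_contracts phi a :
  cutoff_ideal a `<=` rep_ker phi -> contracts phi a.
Proof.
have [g [x [_ _ _ _ gP]]] := cutoff (cstar a); rewrite cstarK in gP.
by move=> aphi; apply/gP/aphi => psi /gP.
Qed.

Lemma scale_above phi a (M : R[i]) : 0 < M -> ~ (forall v, phi a v = 0) ->
  exists k v, M * `|v| < `|phi (k *: a) v|.
Proof.
move=> M0 /existsNP[v /eqP av0].
have pos : 0 < M * `|v| + 1 by rewrite ltr_wpDl// mulr_ge0// ltW.
exists ((M * `|v| + 1) / `|phi a v|), v.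
rewrite repZ (normrZ _ (phi a v)) gtr0_norm ?divr_gt0 ?normr_gt0//.
by rewrite divfK ?normr_eq0// ltrDl.
Qed.

(** The point [d] lies within distance 1 of a multiple [k *: a] for which
    [phi (k *: a)] has norm greater than 2. *)
Lemma cutoff_ideal_dense (D : set A) phi a : dense D -> ~ rep_ker phi a ->
  exists2 d, D d & ~ (cutoff_ideal d `<=` rep_ker phi) /\
    forall psi, rep_ker psi a -> cutoff_ideal d `<=` rep_ker psi.
Proof.
move=> dD phia; have [k [v kv]] := @scale_above phi a 2 (ltr0n _ 2) phia.
have [|d [kd Dd]] := dD (ball (k *: a) 1) _ (ball_open (k *: a) 1).
  by exists (k *: a); exact: ballxx ltr01.
rewrite -ball_normE /= in kd.
exists d => //; split.
  move/cutoff_ideal_contracts => /(_ v) dv.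
  have : `|phi (k *: a) v| <= 2 * `|v|; last first.
    by move=> /(lt_le_trans kv); rewrite ltxx.
  rewrite -(subrK d (k *: a)) repD (le_trans (ler_normD _ _))//.
  rewrite mulr_natl mulr2n lerD//.
  by rewrite (le_trans (rep_norm _ _))// ler_piMl// ltW.
move=> psi psia b; apply=> w.
have -> : psi d w = psi (d - k *: a) w by rewrite repB repZ psia scaler0 subr0.
by rewrite (le_trans (rep_norm _ _))// ler_piMl// distrC ltW.
Qed.

(** The vectors killed by [pi (h a)] for all [a] form a closed invariant
    subspace, which is neither 0 nor the whole space. *)
Lemma rep_ker_prime pi (L : set A) h : irreducible pi -> closed_ideal L ->
  ~ (L `<=` rep_ker pi) -> ~ rep_ker pi h ->
  exists2 l, L l & ~ rep_ker pi (cmul h l).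
Proof.
move=> [_ pi_irr] [_ Li] Lpi pih; apply: contrapT => hL.
pose K : set (rep_space pi) := [set v | forall a, pi (cmul h a) v = 0].
have [|a v Kv c|K0|KT] := pi_irr K.
- split.
  + by move=> a; rewrite linear0.
  + by move=> k v w Kv Kw a; rewrite linearP Kv Kw scaler0 addr0.
  + move=> v clv a.
    have K0 : 0 < `|cmul h a| + 1 by rewrite ltr_wpDl.
    apply: (eq0_small K0) => e e0.
    have /clv[w /= [Kw]] : nbhs v (ball v e) by exact: nbhsx_ballx.
    rewrite -ball_normE /= => vwe; exists `|v - w| => //.
    rewrite -[pi _ v]subr0 -(Kw a) -linearB (le_trans (rep_norm _ _))//.
    by rewrite ler_wpM2r// lerDl.
- by rewrite -repM -cmulA; exact: Kv.
- apply: Lpi => l Ll v; have : K (pi l v); last by rewrite K0.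
  move=> a; rewrite -repM -cmulA; move: v; apply: contrapT => hal.
  by apply: hL; exists (cmul a l) => //; have [] := Li a l Ll.
- apply: pih; rewrite -[h]cstarK; apply: rep_ker_star => v.
  apply/eqP; rewrite -normr_eq0 -sqrf_eq0 rep_star_norm.
  have : K v by rewrite KT.
  by move=> Kv; rewrite Kv linear0l.
Qed.

(** The cutoff applied to a large multiple of [h l], where [l] in [L] is such
    that [pi (h l)] is not 0. *)
Lemma peak pi (L : set A) h : irreducible pi -> closed_ideal L ->
  ~ (L `<=` rep_ker pi) -> ~ rep_ker pi h ->
  exists x h', [/\ L x, `|x| <= 1, cmul x h' = h', exists c, h' = cmul h c &
    ~ rep_ker pi h'].
Proof.
move=> pi_irr cL Lpi pih.
have [l Ll hl] := rep_ker_prime pi_irr cL Lpi pih.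
have hls : ~ (forall v, pi (cstar (cmul h l)) v = 0).
  by move=> /rep_ker_star; rewrite cstarK.
have [k [v kv]] := scale_above ltr01 hls.
have [g [x [[c gE] [b xE] x1 xg gP]]] := cutoff (cmul h (Num.conj k *: l)).
have [[_ LZ _] Li] := cL.
exists x, g; split=> //.
- rewrite xE; apply: (Li _ _ _).2; apply: (Li _ _ _).1.
  by rewrite -[_ *: _]addr0; apply: LZ => //; case: cL => -[].
- by exists (cmul (Num.conj k *: l) c); rewrite cmulA -gE.
- move/gP => /(_ v); rewrite cmulZr cstarZ conjCK.
  by move=> /(lt_le_trans kv); rewrite mul1r ltxx.
Qed.

End representations.

(** * The primitive ideal space and strictly norming sets *)

Section main.
Variables (R : realType) (A : cstarAlgType R).

Lemma prim_countable_nbhs_base : separable_space A ->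
  forall I : Prim A, countable_nbhs_base I.
Proof.
move=> [D cD dD] I; have [pi pi_irr IE] := svalP I.
exists ((fun d => prim_open (cutoff_ideal d)) @`
  (D `&` [set d | ~ (cutoff_ideal d `<=` rep_ker pi)])); split.
- apply: sub_countable (card_image_le _ _) _; apply: sub_countable cD.
  by apply: subset_card_le; exact: subIsetl.
- move=> _ [d [_ Id] <-]; apply: open_nbhs_nbhs; split.
    apply/prim_openP; exists (cutoff_ideal d) => //.
    exact: cutoff_ideal_closed.
  by rewrite /prim_open /= IE.
- move=> U; rewrite nbhsE => -[W [/prim_openP[K cK ->]]].
  rewrite /prim_open /= IE => /existsNP[a /not_implyP[Ka pia]] WU.
  have [d Dd [dpi dK]] := cutoff_ideal_dense dD pia.
  exists (prim_open (cutoff_ideal d)); first by exists d.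
  move=> J /= dJ; apply: WU => /= KJ; have [rho _ JE] := svalP J.
  by apply: dJ; rewrite JE; apply: dK; rewrite -JE; exact: KJ.
Qed.

(** The sequence lists the cutoff ideals of a countable dense set that are not
    contained in [rep_ker pi]; [A] itself is used at the unused indices. *)
Lemma ideal_sequence pi : separable_space A -> irreducible pi ->
  exists L : nat -> set A,
    (forall n, closed_ideal (L n) /\ ~ (L n `<=` rep_ker pi)) /\
    forall phi : representation A, ~ (rep_ker phi `<=` rep_ker pi) ->
      exists n, L n `<=` rep_ker phi.
Proof.
move=> [D /countable_injP[f f_inj] dD] [[a0 [v0 pi0]] _].
have /choice[L LP] : forall n, exists L : set A,
    (closed_ideal L /\ ~ (L `<=` rep_ker pi)) /\
    forall d, D d -> f d = n -> ~ (cutoff_ideal d `<=` rep_ker pi) ->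
      L = cutoff_ideal d.
  move=> n.
  have [[d [Dd fd dpi]]|nd] := pselect (exists d,
      [/\ D d, f d = n & ~ (cutoff_ideal d `<=` rep_ker pi)]).
    exists (cutoff_ideal d); split.
      by split=> //; exact: cutoff_ideal_closed.
    move=> d' Dd' fd' _; congr cutoff_ideal.
    by apply: f_inj; rewrite ?inE// fd fd'.
  exists setT; split; last by move=> d Dd fd dpi; exfalso; apply: nd; exists d.
  split; first exact: closed_idealT.
  by move=> /(_ a0 Logic.I v0)/eqP; exact/negP.
exists L; split=> [n|phi]; first by case: (LP n).
move=> /existsNP[a /not_implyP[phia pia]].
have [d Dd [dpi dphi]] := cutoff_ideal_dense dD pia.
by exists (f d); rewrite ((LP (f d)).2 d Dd erefl dpi); exact: dphi.
Qed.

Lemma peak_sequence pi (L : nat -> set A) : irreducible pi ->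
  (forall n, closed_ideal (L n) /\ ~ (L n `<=` rep_ker pi)) ->
  exists (x h : nat -> A), forall n,
    [/\ L n (x n), `|x n| <= 1, h n != 0 &
        forall k, (k < n)%N -> cmul (x k) (h n) = h n].
Proof.
move=> pi_irr LP.
have [h0 pih0] : exists h0, ~ rep_ker pi h0.
  have [[a0 [v0 pi0]] _] := pi_irr.
  by exists a0 => /(_ v0)/eqP; exact/negP.
have /choice[F FP] : forall nh : nat * A, exists xh : A * A,
    ~ rep_ker pi nh.2 -> [/\ L nh.1 xh.1, `|xh.1| <= 1, cmul xh.1 xh.2 = xh.2,
      exists c, xh.2 = cmul nh.2 c & ~ rep_ker pi xh.2].
  move=> [n h] /=; have [ph|ph] := pselect (rep_ker pi h).
    by exists (0, 0).
  have [cL Lpi] := LP n.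
  have [x [h' H]] := peak pi_irr cL Lpi ph.
  by exists (x, h').
pose h := fix h n := if n is m.+1 then (F (m, h m)).2 else h0.
pose x n := (F (n, h n)).1.
have pih n : ~ rep_ker pi (h n).
  by elim: n => [//|n ih]; have [] := FP (n, h n) ih.
exists x, h => n; have [Lx x1 _ _ _] := FP (n, h n) (pih n).
split=> //.
  by apply/eqP => hn0; apply: (pih n) => v; rewrite hn0 rep0.
elim: n {Lx x1} => [//|n ih] k.
have [_ _ xh [c hE] _] := FP (n, h n) (pih n).
rewrite ltnS leq_eqVlt => /orP[/eqP ->|kn]; first exact: xh.
by rewrite [h n.+1]hE cmulA ih.
Qed.

(** The element [a] is the sum of the series [2^-(n+1) x_n]. Multiplication by
    its [n]-th partial sum scales [h n] by [1 - 2^-n]. *)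
Lemma peak_series (x h : nat -> A) :
  (forall n, `|x n| <= 1) -> (forall n, h n != 0) ->
  (forall n k, (k < n)%N -> cmul (x k) (h n) = h n) ->
  exists a, 1 <= `|a| /\
    (forall n, exists2 q : R[i], q < 1 & `|a - (2^-1 ^+ n.+1) *: x n| <= q).
Proof.
move=> x1 h0 xh.
pose hf : R := 2^-1.
pose u n := \sum_(i < n) (2^-1 ^+ i.+1 : R[i]) *: x i.
pose t n := 1 - hf ^+ n.
have hfE : hf%:C = 2^-1 by rewrite fmorphV rmorph_nat.
have hfXE n : (hf ^+ n)%:C = 2^-1 ^+ n by rewrite rmorphXn /= hfE.
have hX0 n : 0 <= 2^-1 ^+ n :> R[i] by rewrite exprn_ge0// invr_ge0.
have h_ge0 : 0 <= 2^-1 :> R[i] by rewrite invr_ge0.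
have h_lt1 : 2^-1 < 1 :> R[i] by rewrite invf_lt1// ltr1n.
have tS n : t n.+1 - t n = hf ^+ n.+1.
  by rewrite /t exprS /hf; field.
have step n : `|u n.+1 - u n| <= (t n.+1 - t n)%:C.
  rewrite tS hfXE /u big_ord_recr /= addrAC subrr add0r normrZ ger0_norm//.
  by rewrite ler_piMr.
have tM n : t n <= 1 by rewrite gerBl exprn_ge0// invr_ge0.
have uN n : `|u n| <= (t n)%:C.
  elim: n => [|n ih]; first by rewrite /u big_ord0 normr0 /t expr0 subrr.
  rewrite -(subrK (u n) (u n.+1)) -(subrK (t n) (t n.+1)) rmorphD.
  by rewrite (le_trans (ler_normD _ _))// lerD.
have [a [_ aN]] := dominated_cvg step tM.
have {}aN n : `|a - u n| <= 2^-1 ^+ n.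
  by rewrite (le_trans (aN n))// /t subKr hfXE.
exists a; split.
- apply/ler_addgt0Pr => e e0.
  have [n _ /(_ n (leqnn n)) /= nP] :=
    near_expr_small h_ge0 h_lt1 (divr_gt0 e0 (ltr0n _ 2)).
  have nh : 0 < `|h n| by rewrite normr_gt0.
  have uh m : (m <= n)%N -> cmul (u m) (h n) = (t m)%:C *: h n.
    elim: m => [_|m ih mn].
      by rewrite /u big_ord0 cmul0l /t expr0 subrr scale0r.
    rewrite /u big_ord_recr /= cmulDl cmulZl xh// ih ?(ltnW mn)//.
    by rewrite -scalerDl -hfXE -rmorphD -tS addrC subrK.
  rewrite -(ler_pM2r nh) mul1r.
  have hE : h n = cmul a (h n) - cmul (a - u n) (h n) + 2^-1 ^+ n *: h n.
    rewrite cmulDl cmulNl opprB addrCA subrr addr0 uh// -scalerDl -hfXE.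
    by rewrite -rmorphD /t subrK scale1r.
  rewrite {1}hE (le_trans (ler_normD _ _))//.
  rewrite (le_trans (lerD (ler_normB _ _) (lexx _)))//.
  rewrite normrZ (ger0_norm (hX0 n)) -addrA mulrDl lerD ?cnormM//.
  rewrite (le_trans (lerD (cnormM _ _) (lexx _)))// -mulrDl ler_wpM2r//.
  by rewrite [e]splitr lerD ?(le_trans (aN n))// ltW.
- move=> n; exists (t n + hf ^+ n.+1)%:C.
    rewrite -(rmorph1 (real_complex R)) ltcR /t.
    rewrite exprS -ltrBrDr ltrD2l ltrN2.
    by rewrite gtr_pMl ?exprn_gt0 ?invf_lt1 ?ltr1n ?invr_gt0.
  have -> : a - 2^-1 ^+ n.+1 *: x n = u n + (a - u n.+1).
    by rewrite [RHS]addrC /u big_ord_recr /= opprD addrA addrAC subrK.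
  by rewrite (le_trans (ler_normD _ _))// rmorphD /= lerD ?uN// hfXE.
Qed.

Lemma strictly_norming_exhausting (F : representation A -> Prop) :
  separable_space A -> strictly_norming F -> exhausting F.
Proof.
move=> sepA [Fu Fnu] pi pi_irr; apply: contrapT => Fpi.
have [L [LP Lphi]] := ideal_sequence sepA pi_irr.
have [x [h xhP]] := peak_sequence pi_irr LP.
have [|||a [a1 aq]] := @peak_series x h.
- by move=> n; case: (xhP n).
- by move=> n; case: (xhP n).
- by move=> n k; case: (xhP n) => _ _ _; apply.
have small phi : F phi -> opnorm (phi a) < `|a|.
  move=> Fphi; have [|n Ln] := Lphi phi.
    by move=> kphi; apply: Fpi; exists phi.
  have [q q1 aqn] := aq n; apply: lt_le_trans a1; apply: le_lt_trans q1.
  have [Lx _ _ _] := xhP n.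
  apply: opnorm_le => v v1.
  have -> : phi a v = phi (a - 2^-1 ^+ n.+1 *: x n) v.
    by rewrite repB repZ (Ln _ Lx) scaler0 subr0.
  by rewrite (le_trans (rep_norm _ _))// (le_trans _ aqn)// ler_piMr.
have [uA|nuA] := pselect (unital A).
  have [phi /small + aE] := Fu uA a; by rewrite -aE ltxx.
have a0 : 0 < `|a| by exact: lt_le_trans a1.
have := Fnu nuA a 0; rewrite scale0r add0r normr_inU normr0.
move=> [[phi /small + aE]|aE].
  rewrite aE (_ : (fun v => _) = phi a) ?ltxx//.
  by apply/funext => v; rewrite scale0r add0r.
by rewrite aE ltxx in a0.
Qed.

End main.

Theorem theorem4p4 (R : realType) (A : cstarAlgType R) :
  separable_space A ->
  (forall I : Prim A, countable_nbhs_base I) /\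
  (forall F : representation A -> Prop, strictly_norming F -> exhausting F).
Proof.
move=> sepA; split; first exact: prim_countable_nbhs_base.
by move=> F; exact: strictly_norming_exhausting.
Qed.
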